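(* Let $\dot A$ be a symmetric densely defined closed operator with deficiency indices $(1,1)$ in a Hilbert space $\mathcal H$ and let $g_\pm\in\operatorname{Ker}(\dot A^*\mp iI)$ be $(+)$-normalized deficiency vectors, $\|g_\pm\|_+=1$. Assume that $A$ is a self-adjoint extension of $\dot A$ such that $g_+-g_-\in\mathrm{Dom}(A)$, and let $M_{(\dot A,A)}(z)$ denote the Weyl-Titchmarsh function of the pair $(\dot A,A)$. Then for any $a\in(0,1)$ the function $aM_{(\dot A,A)}(z)$ can be represented as the impedance function of an L-system of the form $$\Theta_{1a}=\begin{pmatrix}\mathbb A_{1a}&K_{1a}&1\\ \mathcal H_+\subset\mathcal H\subset\mathcal H_-&&\mathbb C\end{pmatrix},$$ $$\mathbb A_{1a}=\dot A^*-\tfrac i2\big(\cdot,(1-a)\varphi+(1+a)\psi\big)(\varphi-\psi),\quad K_{1a}c=c\cdot\sqrt{\tfrac a2}\,(\varphi-\psi)\ (c\in\mathbb C),$$ where $\varphi=\mathcal R^{-1}g_+$, $\psi=\mathcal R^{-1}g_-$, with c-entropy $\mathcal S$ and coefficient of dissipation $\mathcal D$ of the main operator of $\Theta_{1a}$ given by $$\mathcal S=\ln(1+a)-\ln(1-a)\quad\text{and}\quad\mathcal D=\frac{4a}{(1+a)^2},$$ respectively. Moreover, if $\Theta$ is an L-system with state-space operator $\mathbb A$ and symmetric operator $\dot A$ such that $V_\Theta(z)=aM_{(\dot A,A)}(z)$ for $z\in\mathbb C_+$, where $A=\hat A$ is the quasi-kernel of $\mathrm{Re}\,\mathbb A$,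 then $\Theta$ has c-entropy $\mathcal S=\ln(1+a)-\ln(1-a)$ and coefficient of dissipation of the main operator $\mathcal D=\frac{4a}{(1+a)^2}$.
   Context: Inner products are linear in the first argument. $\mathbb C_\pm$ are the open upper and lower half-planes. Rigged space. For a closed densely defined symmetric $\dot A$ in $\mathcal H$, $\mathcal H_+=\mathrm{Dom}(\dot A^* )$ with $(f,g)_+=(f,g)+(\dot A^*f,\dot A^*g)$, and $\mathcal H_-$ is the corresponding negative space (dual of $\mathcal H_+$ with respect to the pairing extending the inner product of $\mathcal H$, also written $(\cdot,\cdot)$), so $\mathcal H_+\subset\mathcal H\subset\mathcal H_-$. The Riesz-Berezansky operator $\mathcal R$ is the isometric (linear) map of $\mathcal H_-$ onto $\mathcal H_+$ with $(f,g)=(f,\mathcal Rg)_+$ for $f\in\mathcal H_+$, $g\in\mathcal H_-$. $[\mathcal H_1,\mathcal H_2]$ denotes bounded linear operators. For $\mathbb A\in[\mathcal H_+,\mathcal H_-]$ the adjoint $\mathbb A^*\in[\mathcal H_+,\mathcal H_-]$ is taken with respect to the pairing; $\mathrm{Re}\,\mathbb A=\frac12(\mathbb A+\mathbb A^* )$, $\mathrm{Im}\,\mathbb A=\frac1{2i}(\mathbb A-\mathbb A^* )$. For $u,v\in\mathcal H_-$, $(\cdot,u)v$ denotes the operator $f\mapsto(f,u)v$ from $\mathcal H_+$ to $\mathcal H_-$. Extensions. A quasi-self-adjoint extension of $\dot A$ is a non-symmetric operator $T$ in $\mathcal H$ with $\dot A\subset T\subset\dot A^*$. A self-adjoint bi-extension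 of $\dot A$ is $\mathbb B\in[\mathcal H_+,\mathcal H_-]$ with $\dot A\subset\mathbb B=\mathbb B^*$; its quasi-kernel is the restriction of $\mathbb B$ to $\{f\in\mathcal H_+:\mathbb Bf\in\mathcal H\}$; it is t-self-adjoint if its quasi-kernel is self-adjoint in $\mathcal H$. If $T$ is a quasi-self-adjoint extension of $\dot A$ with $\rho(T)\neq\emptyset$, a $( * )$-extension of $T$ is $\mathbb A\in[\mathcal H_+,\mathcal H_-]$ with $\mathbb A\supset T\supset\dot A$, $\mathbb A^*\supset T^*\supset\dot A$ and $\mathrm{Re}\,\mathbb A$ a t-self-adjoint bi-extension of $\dot A$. L-system. An array $\Theta=\begin{pmatrix}\mathbb A&K&1\\ \mathcal H_+\subset\mathcal H\subset\mathcal H_-&&\mathbb C\end{pmatrix}$ is an L-system if (1) $T$ is a dissipative ($\mathrm{Im}(Tf,f)\ge0$, $f\in\mathrm{Dom}(T)$) quasi-self-adjoint extension, with $\rho(T)\ne\emptyset$, of a symmetric operator $\dot A$ with deficiency indices $(1,1)$; (2) $\mathbb A$ is a $( * )$-extension of $T$; (3) $\mathrm{Im}\,\mathbb A=KK^*$ with $K\in[\mathbb C,\mathcal H_-]$, $K^*\in[\mathcal H_+,\mathbb C]$. Here $\dot A$, $T$, $\mathbb A$, $K$ are the symmetric, main, state-space and channel operators. The transfer function is $W_\Theta(z)=I-2iK^*(\mathbb A-zI)^{-1}K$, $z\in\rho(T)$, and the impedance function is $V_\Theta(z)=K^*(\mathrm{Re}\,\mathbb A-zI)^{-1}K$ for nonreal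 $z\in\rho(T)$, extended analytically to all of $\mathbb C_\pm$. Weyl-Titchmarsh function: for a self-adjoint extension $A$ of $\dot A$, $M_{(\dot A,A)}(z)=((Az+I)(A-zI)^{-1}g,g)$, $z\in\mathbb C_+$, where $g\in\operatorname{Ker}(\dot A^*-iI)$ has $\|g\|=1$ in the norm of $\mathcal H$ (e.g. $g=\sqrt2\,g_+$ for $(+)$-normalized $g_+$). c-entropy: $\mathcal S=-\ln(|W_\Theta(-i)|)$, with $\mathcal S=\infty$ if $W_\Theta(-i)=0$. Coefficient of dissipation: let $g'_\pm=\sqrt2\,g_\pm$, so $\|g'_\pm\|=1$ in $\mathcal H$, and let $\kappa$ be the von Neumann parameter of $T$, i.e. the number $|\kappa|<1$ with $g'_+-\kappa g'_-\in\mathrm{Dom}(T)$ (in the definition it is required that the basis is such that $0\le\kappa\le1$). With $\tilde y=g'_+-\kappa g'_-$, $\mathcal D=\mathrm{Im}(T\tilde y,\tilde y)$. *)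

(* Defs.v *)
From HB Require Import structures.
From mathcomp Require Import all_boot all_order all_algebra.
From mathcomp Require Import complex.
From mathcomp Require Import all_classical all_reals all_analysis.

Set Implicit Arguments.
Unset Strict Implicit.
Unset Printing Implicit Defensive.

Import Order.TTheory GRing.Theory Num.Theory numFieldNormedType.Exports.
Local Open Scope classical_set_scope.
Local Open Scope complex_scope.
Local Open Scope ring_scope.

(* The inner product is linear in its first argument.  The norm of a normed
   module over [R[i]] takes its values in [R[i]] (and is real there). *)
HB.mixin Record isHilbert (R : realType) H of CompleteNormedModule R[i] H := {
  dotp : H -> H -> R[i];
  dotpP : forall (a : R[i]) (x y z : H),
    dotp (a *: x + y) z = a * dotp x z + dotp y z;
  dotpC : forall x y : H, dotp x y = (dotp y x)^*;
  dotp_norm : forall x : H, dotp x x = `|x| ^+ 2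
}.

#[short(type="hilbertType")]
HB.structure Definition Hilbert (R : realType) :=
  { H of isHilbert R H & CompleteNormedModule R[i] H }.

Section HilbertTheory.
Variables (R : realType) (H : hilbertType R).
Implicit Types (x y z : H) (a : R[i]).

Lemma dotpDl x y z : dotp (x + y) z = dotp x z + dotp y z.
Proof. by rewrite -[x in LHS]scale1r dotpP mul1r. Qed.

Lemma dotp0l z : dotp (0 : H) z = 0.
Proof.
have := dotpDl 0 0 z; rewrite addr0 => /(congr1 (fun t => t - dotp 0 z)).
by rewrite subrr addrK => /esym.
Qed.

Lemma dotpZl a x z : dotp (a *: x) z = a * dotp x z.
Proof. by rewrite -[a *: x]addr0 dotpP dotp0l addr0. Qed.

Lemma dotpDr x y z : dotp z (x + y) = dotp z x + dotp z y.
Proof. by rewrite dotpC dotpDl rmorphD /= -!(dotpC z). Qed.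

Lemma dotpZr a x z : dotp z (a *: x) = a^* * dotp z x.
Proof. by rewrite dotpC dotpZl rmorphM /= -(dotpC z). Qed.

Lemma dotp0r z : dotp z (0 : H) = 0.
Proof. by rewrite dotpC dotp0l rmorph0. Qed.

Lemma dotpBl x y z : dotp (x - y) z = dotp x z - dotp y z.
Proof. by rewrite dotpDl -scaleN1r dotpZl mulN1r. Qed.

Lemma dotpBr x y z : dotp z (x - y) = dotp z x - dotp z y.
Proof. by rewrite dotpC dotpBl rmorphB /= -!(dotpC z). Qed.

Lemma cauchy_schwarz x y : `|dotp x y| <= `|x| * `|y|.
Proof.
have [->|y0] := eqVneq y 0; first by rewrite dotp0r !normr0 mulr0.
have ny0 : 0 < `|y| by rewrite normr_gt0.
set c := dotp x y / `|y| ^+ 2.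
have n2 : 0 < `|y| ^+ 2 by rewrite exprn_gt0.
have cy : c * `|y| ^+ 2 = dotp x y by rewrite /c divfK // gt_eqF.
have : 0 <= dotp (x - c *: y) (x - c *: y) by rewrite dotp_norm exprn_ge0.
rewrite !(dotpBl, dotpBr) !(dotpZl, dotpZr) !dotp_norm.
rewrite mulrCA cy opprB addrA subrK subr_ge0 => h.
rewrite -(@ler_pXn2r _ 2) ?nnegrE ?mulr_ge0 // exprMn -ler_pdivrMr //.
apply: le_trans h; by rewrite normCK -dotpC mulrAC -/c.
Qed.

End HilbertTheory.

Section Operators.
Variables (R : realType) (H : hilbertType R).
Implicit Types (S T : set (H * H)) (f g h : H) (z : R[i]).

Definition opdom T : set H := [set f | exists h, T (f, h)].

Definition linear_operator T :=
  [/\ T (0, 0), forall (c : R[i]) p q, T p -> T q -> T (c *: p + q)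
    & forall h, T (0, h) -> h = 0].

(* The value [T f], for [f] in the domain of [T] ([0] elsewhere). *)
Definition opval T f : H := xget 0 [set h | T (f, h)].

Definition adjoint T : set (H * H) :=
  [set p | forall f h, T (f, h) -> dotp h p.1 = dotp f p.2].

Definition symmetric_op T := T `<=` adjoint T.
Definition selfadjoint_op T := T = adjoint T.

Definition dissipative T :=
  forall f h, T (f, h) -> 0 <= complex.Im (dotp h f).

(* The resolvent set: [T - z I] is a bijection of [opdom T] onto the whole
   space, with a bounded inverse. *)
Definition resolvent_set T : set R[i] := [set z |
  (forall h, exists! f, T (f, h + z *: f)) /\
  exists M : R[i], forall f h, T (f, h) -> `|f| <= M * `|h - z *: f|].

(* [(T - z I)^-1 h]; the value is [0] when it does not exist. *)
Definition resolvent T z h : H := xget 0 [set f | T (f, h + z *: f)].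

Definition one_dimensional (V : set H) :=
  exists2 g : H, g != 0 & V = [set c *: g | c in [set: R[i]]].

(* [Ker (T^* - z I)] *)
Definition defect_space T z : set H := [set g | adjoint T (g, z *: g)].

Definition deficiency_indices_11 T :=
  one_dimensional (defect_space T 'i) /\ one_dimensional (defect_space T (- 'i)).

End Operators.

Record symOp (R : realType) (H : hilbertType R) := SymOp {
  graph :> set (H * H);
  symOp_linear : linear_operator graph;
  symOp_closed : closed graph;
  symOp_dense : dense (opdom graph);
  symOp_symmetric : symmetric_op graph
}.

Section AdjointTheory.
Variables (R : realType) (H : hilbertType R).

Lemma adjoint_linear (T : set (H * H)) (c : R[i]) p q :
  adjoint T p -> adjoint T q -> adjoint T (c *: p + q).
Proof.
move=> hp hq f h Tfh /=.
by rewrite !(dotpDr, dotpZr) (hp _ _ Tfh) (hq _ _ Tfh).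
Qed.

Lemma dense_orthogonal (D : set H) (y : H) :
  dense D -> (forall f, D f -> dotp f y = 0) -> y = 0.
Proof.
move=> dD oy; apply/eqP/negPn/negP => y0.
have ny0 : 0 < `|y| by rewrite normr_gt0.
have [||f [/= yf Df]] := dD (ball y `|y|).
- by exists y; apply: ballxx.
- exact: ball_open.
have : `|y| ^+ 2 <= `|y - f| * `|y|.
  rewrite -dotp_norm -[dotp y y]subr0 -(oy _ Df) -dotpBl.
  apply: le_trans (cauchy_schwarz _ _).
  by rewrite dotpBl (oy _ Df) subr0 dotp_norm ger0_norm // exprn_ge0.
rewrite expr2 ler_pM2r // => le.
move: yf; rewrite -ball_normE /= => lt.
by have := le_lt_trans le lt; rewrite ltxx.
Qed.

Variable A : symOp H.

Lemma adjoint_fun f h h' : adjoint A (f, h) -> adjoint A (f, h') -> h = h'.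
Proof.
move=> hh hh'; apply/eqP; rewrite -subr_eq0; apply/eqP.
apply: (dense_orthogonal (symOp_dense A)) => g [k Agk].
by rewrite dotpBr -(hh _ _ Agk) -(hh' _ _ Agk) subrr.
Qed.

Definition Hplus_pred : {pred H} := fun f => `[< opdom (adjoint A) f >].

Lemma Hplus_submod : submod_closed Hplus_pred.
Proof.
split; first by apply/asboolP; exists 0 => f h _ /=; rewrite !dotp0r.
move=> c f g /asboolP[h fh] /asboolP[k gk]; apply/asboolP.
by exists (c *: h + k); have := adjoint_linear c fh gk.
Qed.

HB.instance Definition _ :=
  GRing.isSubmodClosed.Build R[i] H Hplus_pred Hplus_submod.

Record Hplus := HplusMk {
  Hplus_val :> H;
  _ : Hplus_val \in Hplus_pred
}.

HB.instance Definition _ := [isSub for Hplus_val].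
HB.instance Definition _ := [Choice of Hplus by <:].
HB.instance Definition _ := [SubChoice_isSubLmodule of Hplus by <:].

Lemma HplusP (f : Hplus) : opdom (adjoint A) f.
Proof. by case: f => f fP; exact/asboolP. Qed.

(* [A^* f] *)
Definition astar (f : Hplus) : H := opval (adjoint A) f.

Lemma astarP (f : Hplus) : adjoint A (f : H, astar f).
Proof. by have [h Ah] := HplusP f; exact: (@xgetI _ 0 [set k | adjoint A (f : H, k)] h Ah). Qed.

Lemma astar_linear (c : R[i]) (f g : Hplus) :
  astar (c *: f + g) = c *: astar f + astar g.
Proof.
exact: (adjoint_fun (astarP (c *: f + g))
                    (adjoint_linear c (astarP f) (astarP g))).
Qed.

Definition dotplus (f g : Hplus) : R[i] :=
  dotp (f : H) (g : H) + dotp (astar f) (astar g).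

Definition normplus (f : Hplus) : R[i] := sqrtC (dotplus f f).

Lemma dotplus_norm (f : Hplus) :
  dotplus f f = `|f : H| ^+ 2 + `|astar f| ^+ 2.
Proof. by rewrite /dotplus !dotp_norm. Qed.

Lemma normplus_ge0 (f : Hplus) : 0 <= normplus f.
Proof. by rewrite sqrtC_ge0 dotplus_norm addr_ge0 ?exprn_ge0. Qed.

Lemma le_normplus (f : Hplus) : `|f : H| <= normplus f.
Proof.
rewrite -(@ler_pXn2r _ 2) ?nnegrE ?normplus_ge0 //.
by rewrite sqrtCK dotplus_norm lerDl exprn_ge0.
Qed.

Lemma le_astar_normplus (f : Hplus) : `|astar f| <= normplus f.
Proof.
rewrite -(@ler_pXn2r _ 2) ?nnegrE ?normplus_ge0 //.
by rewrite sqrtCK dotplus_norm lerDr exprn_ge0.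
Qed.

(* H_- is the space of bounded conjugate-linear functionals on H_+: [u] in H_-
   is the functional [f |-> (u, f)], so that linear operations on H_- are
   pointwise. *)
Definition Hminus_pred : {pred (Hplus -> R[i]^o)} := fun u => `[<
  (forall (c : R[i]) f g, u (c *: f + g) = c^* * u f + u g) /\
  exists M : R[i], forall f, `|u f| <= M * normplus f >].

Lemma Hminus_submod : submod_closed Hminus_pred.
Proof.
split.
  apply/asboolP; split=> [c f g|]; first by rewrite mulr0 addr0.
  by exists 0 => f; rewrite normr0 mul0r.
move=> c u v /asboolP[lu [M bu]] /asboolP[lv [N bv]]; apply/asboolP; split.
  move=> d f g; rewrite !fctE lu lv /GRing.scale /=.
  by rewrite !mulrDr addrACA mulrCA.
exists (`|c| * M + N) => f; apply: (le_trans (ler_normD _ _)).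
by rewrite mulrDl lerD // normrM -mulrA ler_wpM2l.
Qed.

HB.instance Definition _ :=
  GRing.isSubmodClosed.Build R[i] (Hplus -> R[i]^o) Hminus_pred Hminus_submod.

Record Hminus := HminusMk {
  Hminus_val :> Hplus -> R[i]^o;
  _ : Hminus_val \in Hminus_pred
}.

HB.instance Definition _ := [isSub for Hminus_val].
HB.instance Definition _ := [Choice of Hminus by <:].
HB.instance Definition _ := [SubChoice_isSubLmodule of Hminus by <:].

Lemma HminusP (u v : Hminus) : u =1 v -> u = v.
Proof. by move=> uv; apply: val_inj; apply/funext. Qed.

Lemma Hminus_linear (u : Hminus) (c : R[i]) f g :
  u (c *: f + g) = c^* * u f + u g.
Proof. by case: u => u uP /=; have /asboolP[] := uP. Qed.

Lemma Hminus_bounded (u : Hminus) :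
  exists M : R[i], forall f, `|u f| <= M * normplus f.
Proof. by case: u => u uP /=; have /asboolP[] := uP. Qed.

(* [(f, u)] for [f] in H_+ and [u] in H_- *)
Definition pairing (f : Hplus) (u : Hminus) : R[i] := (u f)^*.

Lemma embed_subproof (h : H) :
  (fun f : Hplus => dotp h (f : H)) \in Hminus_pred.
Proof.
apply/asboolP; split=> [c f g|]; first by rewrite dotpDr dotpZr.
exists `|h| => f; apply: (le_trans (cauchy_schwarz _ _)).
by rewrite ler_wpM2l // le_normplus.
Qed.

Definition embed (h : H) : Hminus := HminusMk (embed_subproof h).

Lemma riesz_inv_subproof (g : Hplus) :
  (fun f : Hplus => dotplus g f) \in Hminus_pred.
Proof.
apply/asboolP; split=> [c f k|].
  by rewrite /dotplus astar_linear !dotpDr !dotpZr mulrDr addrACA.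
exists (`|g : H| + `|astar g|) => f.
rewrite /dotplus mulrDl; apply: (le_trans (ler_normD _ _)).
by apply: lerD; apply: (le_trans (cauchy_schwarz _ _));
  rewrite ler_wpM2l ?le_normplus ?le_astar_normplus.
Qed.

(* The inverse of the Riesz-Berezansky operator; see [riesz_invP]. *)
Definition riesz_inv (g : Hplus) : Hminus := HminusMk (riesz_inv_subproof g).

Lemma dotplusC (f g : Hplus) : dotplus f g = (dotplus g f)^*.
Proof. by rewrite /dotplus rmorphD /= -!dotpC. Qed.

Lemma riesz_invP (u : Hminus) (g : Hplus) :
  (forall f, pairing f u = dotplus f g) <-> u = riesz_inv g.
Proof.
split=> [ug|-> f]; last by rewrite dotplusC.
by apply: HminusP => f; rewrite -[u f]conjCK -/(pairing f u) ug -dotplusC.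
Qed.

(* The bound says that the norm of [B f] in H_- is at most [M] times the norm
   of [f] in H_+. *)
Definition biop_pred : {pred (Hplus -> Hminus)} := fun B => `[<
  (forall (c : R[i]) f g, B (c *: f + g) = c *: B f + B g) /\
  exists M : R[i], forall f g, `|B f g| <= M * normplus f * normplus g >].

Lemma biop_submod : submod_closed biop_pred.
Proof.
split.
  apply/asboolP; split=> [c f g|]; first by rewrite /= scaler0 addr0.
  by exists 0 => f g; rewrite normr0 !mul0r.
move=> c B C /asboolP[lB [M bB]] /asboolP[lC [N bC]]; apply/asboolP; split.
  move=> d f g; rewrite !fctE lB lC !scalerDr addrACA !scalerA.
  by rewrite [c * d]mulrC.
exists (`|c| * M + N) => f g; apply: (le_trans (ler_normD _ _)).
by rewrite !mulrDl lerD // normrM -!mulrA ler_wpM2l // mulrA.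
Qed.

HB.instance Definition _ :=
  GRing.isSubmodClosed.Build R[i] (Hplus -> Hminus) biop_pred biop_submod.

Record biop := BiopMk {
  biop_val :> Hplus -> Hminus;
  _ : biop_val \in biop_pred
}.

HB.instance Definition _ := [isSub for biop_val].
HB.instance Definition _ := [Choice of biop by <:].
HB.instance Definition _ := [SubChoice_isSubLmodule of biop by <:].

Lemma biop_linear (B : biop) (c : R[i]) f g :
  B (c *: f + g) = c *: B f + B g.
Proof. by case: B => B BP /=; have /asboolP[] := BP. Qed.

Lemma biop_bounded (B : biop) :
  exists M : R[i], forall f g, `|B f g| <= M * normplus f * normplus g.
Proof. by case: B => B BP /=; have /asboolP[] := BP. Qed.

Lemma biadj_val_subproof (B : biop) (g : Hplus) :
  (fun f : Hplus => (B f g)^*) \in Hminus_pred.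
Proof.
apply/asboolP; split=> [c f k|].
  by rewrite biop_linear rmorphD rmorphM.
have [M bM] := biop_bounded B; exists (M * normplus g) => f.
by rewrite norm_conjC mulrAC.
Qed.

Definition biadj_val (B : biop) (g : Hplus) : Hminus :=
  HminusMk (biadj_val_subproof B g).

Lemma biadj_subproof (B : biop) : biadj_val B \in biop_pred.
Proof.
apply/asboolP; split=> [c f g|].
  by apply: HminusP => k /=; rewrite Hminus_linear rmorphD rmorphM /= conjCK.
have [M bM] := biop_bounded B; exists M => f g /=.
by rewrite norm_conjC mulrAC.
Qed.

Definition biadj (B : biop) : biop := BiopMk (biadj_subproof B).

Lemma biadjP (B : biop) (f g : Hplus) : B f g = pairing f (biadj B g).
Proof. by rewrite /pairing /= conjCK. Qed.

Definition bi_re (B : biop) : biop := 2^-1 *: (B + biadj B).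
Definition bi_im (B : biop) : biop := (2 * 'i)^-1 *: (B - biadj B).

Lemma rank_one_subproof (u v : Hminus) :
  (fun f : Hplus => pairing f u *: v) \in biop_pred.
Proof.
apply/asboolP; split=> [c f g|].
  by rewrite /pairing Hminus_linear rmorphD rmorphM /= conjCK scalerDl scalerA.
have [M bM] := Hminus_bounded u; have [N bN] := Hminus_bounded v.
exists (M * N) => f g.
have -> : M * N * normplus f * normplus g = (M * normplus f) * (N * normplus g).
  by rewrite -!mulrA; congr (_ * _); rewrite mulrCA.
by rewrite /= normrM ler_pM // norm_conjC.
Qed.

(* [(., u) v] *)
Definition rank_one (u v : Hminus) : biop := BiopMk (rank_one_subproof u v).

Lemma bi_astar_subproof : (fun f : Hplus => embed (astar f)) \in biop_pred.
Proof.
apply/asboolP; split=> [c f g|].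
  by apply: HminusP => k /=; rewrite astar_linear dotpP.
exists 1 => f g; rewrite mul1r; apply: (le_trans (cauchy_schwarz _ _)).
by apply: ler_pM; rewrite ?le_normplus ?le_astar_normplus.
Qed.

(* [A^*], as an operator from H_+ to H_- *)
Definition bi_astar : biop := BiopMk bi_astar_subproof.

(* [(B - z I)^-1 u]; the value is [0] when it does not exist. *)
Definition bi_resolvent (B : biop) (z : R[i]) (u : Hminus) : Hplus :=
  xget 0 [set f | B f - z *: embed f = u].

Definition bi_extends (T : set (H * H)) (B : biop) :=
  forall f h, T (f, h) -> exists2 k : Hplus, k = f :> H & B k = embed h.

Definition quasi_kernel (B : biop) : set (H * H) :=
  [set p | exists2 f : Hplus, f = p.1 :> H & B f = embed p.2].

Definition selfadjoint_biextension (B : biop) :=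
  bi_extends A B /\ B = biadj B.

Definition t_selfadjoint_biextension (B : biop) :=
  selfadjoint_biextension B /\ selfadjoint_op (quasi_kernel B).

Definition quasi_selfadjoint_extension (T : set (H * H)) :=
  [/\ linear_operator T, A `<=` T, T `<=` adjoint A & ~ symmetric_op T].

Definition star_extension (T : set (H * H)) (B : biop) :=
  [/\ bi_extends T B /\ A `<=` T,
      bi_extends (adjoint T) (biadj B) /\ A `<=` adjoint T
    & t_selfadjoint_biextension (bi_re B)].

(* [K^* f] for [K] in [[C, H_-]]; see [channel_adjP]. *)
Definition channel_adj (K : {linear R[i]^o -> Hminus}) (f : Hplus) : R[i] :=
  pairing f (K 1).

Lemma channel_adjP (K : {linear R[i]^o -> Hminus}) (f : Hplus) (c : R[i]) :
  channel_adj K f * c^* = pairing f (K c).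
Proof.
have -> : K c = c *: K 1 by rewrite -linearZ /= /GRing.scale /= mulr1.
by rewrite /channel_adj /pairing /= rmorphM mulrC.
Qed.

End AdjointTheory.

Record Lsystem (R : realType) (H : hilbertType R) (A : symOp H) := LSystem {
  main_op : set (H * H);
  state_op : biop A;
  channel_op : {linear R[i]^o -> Hminus A};
  Lsys_deficiency : deficiency_indices_11 A;
  Lsys_main : quasi_selfadjoint_extension A main_op;
  Lsys_dissipative : dissipative main_op;
  Lsys_resolvent : resolvent_set main_op !=set0;
  Lsys_state : star_extension main_op state_op;
  Lsys_channel : forall f : Hplus A,
    bi_im state_op f = channel_op (channel_adj channel_op f)
}.

Section LSystems.
Variables (R : realType) (H : hilbertType R) (A : symOp H).
Implicit Types Theta : Lsystem A.

Definition transfer Theta (z : R[i]) : R[i] :=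
  1 - 2 * 'i * channel_adj (channel_op Theta)
    (bi_resolvent (state_op Theta) z (channel_op Theta 1)).

(* [V] is the impedance function.  The formula [K^* (Re A - z I)^-1 K] makes
   sense at every nonreal [z], whether or not [z] belongs to the resolvent set
   of the main operator, and it is analytic: it is its own analytic extension
   to the two open half-planes. *)
Definition is_impedance Theta (V : R[i] -> R[i]) :=
  forall z : R[i], complex.Im z != 0 ->
    V z = channel_adj (channel_op Theta)
            (bi_resolvent (bi_re (state_op Theta)) z (channel_op Theta 1))
    /\ derivable (V : R[i]^o -> R[i]^o) z 1.

Definition c_entropy Theta : \bar R :=
  if transfer Theta (- 'i) == 0 then +oo%E
  else (- ln (complex.Re `|transfer Theta (- 'i)|))%:E.

End LSystems.

Section Functions.
Variables (R : realType) (H : hilbertType R).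

(* The Weyl-Titchmarsh function [((B z + I) (B - z I)^-1 g, g)] of a
   self-adjoint extension [B], for a unit deficiency vector [g]. *)
Definition weyl_titchmarsh (B : set (H * H)) (g : H) (z : R[i]) : R[i] :=
  let f := resolvent B z g in dotp (z *: opval B f + f) g.

(* [D] is the coefficient of dissipation of [T] with respect to the deficiency
   vectors [gp] and [gm], normalized by 1 in the (+)-norm (hence the factor
   [sqrt 2]); the basis has to be such that [kappa] is nonnegative. *)
Definition dissipation_coefficient (T : set (H * H)) (gp gm : H) (D : R) :=
  exists2 kappa : R, 0 <= kappa < 1 &
    let y := (Num.sqrt 2)%:C *: gp - kappa%:C *: ((Num.sqrt 2)%:C *: gm) in
    opdom T y /\ D = complex.Im (dotp (opval T y) y).

End Functions.

(* Main.v *)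
(* By von Neumann's decomposition every f in H_+ is f0 + p g_+ + q g_- with f0
   in the domain of the symmetric operator A0 and p = (f, phi), q = (f, psi),
   and Green's formula reads
     (A0^* f, k) - (f, A0^* k) = i (p(f) p(k)^* - q(f) q(k)^* ).
   Hence a bi-extension B of A0 is A0^* plus a 2x2 matrix acting on (p, q), and
   extensions, adjoints, real and imaginary parts become matrix conditions: the
   extension A is p + q = 0, and Theta_1a has main operator
   (1 - a) p + (1 + a) q = 0.  A defect vector at z gives
   V(z) = i a (p - q) / (p + q), and choosing g + (z - i)(A - z)^-1 g as this
   vector identifies V with aM.

   Conversely, if Re B has quasi-kernel A then its matrix has the rows (s, s)
   and (s^*, s^* ) with Im s = -1/2; since the main operator is not contained in
   p + q = 0, the channel vector is m (s phi + s^* psi).  The single value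
   V(i) = a M(i) = a i then forces s = -i/2 and |m|^2 = 2a, which gives back
   the state-space operator of Theta_1a; so the entropy and the dissipation
   coefficient need only be computed once, in this general situation. *)

Require Import Defs.
From HB Require Import structures.
From mathcomp Require Import all_boot all_order all_algebra.
From mathcomp Require Import complex ring.
From mathcomp Require Import all_classical all_reals all_analysis.

Set Implicit Arguments.
Unset Strict Implicit.
Unset Printing Implicit Defensive.

Import Order.TTheory GRing.Theory Num.Theory numFieldNormedType.Exports.
Local Open Scope classical_set_scope.
Local Open Scope complex_scope.
Local Open Scope ring_scope.

(** * Hilbert space geometry and symmetric operators *)

Section HilbertGeometry.
Variables (R : realType) (H : hilbertType R).
Implicit Types (S : set (H * H)) (x y h f k n : H) (z c d e : R[i]).

Lemma dotpNl x y : dotp (- x) y = - dotp x y.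
Proof. by rewrite -scaleN1r dotpZl mulN1r. Qed.

Definition dotpl := (dotpBl, dotpDl, dotpNl, dotpZl, dotp0l).

Lemma dotp_ext x y : (forall n, dotp x n = dotp y n) -> x = y.
Proof.
move=> xy; apply/eqP; rewrite -subr_eq0 -normr_eq0 -sqrf_eq0 -dotp_norm.
by rewrite dotpBl xy subrr.
Qed.

Lemma parallelogram x y :
  `|x + y| ^+ 2 + `|x - y| ^+ 2 = 2 * (`|x| ^+ 2 + `|y| ^+ 2).
Proof. by rewrite -!dotp_norm !(dotpBl, dotpBr, dotpDl, dotpDr); ring. Qed.

(** The projection coefficient [c = (n, x) / |x|^2] is the decisive test: it lowers the squared norm
    of [n] by [|(n, x)|^2 / |x|^2], so minimality makes this zero. *)
Lemma minimal_norm_orthogonal n x :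
  (forall c, `|n| <= `|n - c *: x|) -> dotp n x = 0.
Proof.
move=> min_n; have [->|x0] := eqVneq x 0; first by rewrite dotp0r.
have nx2 : 0 < `|x| ^+ 2 by rewrite exprn_gt0 // normr_gt0.
set c := dotp n x / `|x| ^+ 2.
have cx : c * `|x| ^+ 2 = dotp n x by rewrite /c divfK // gt_eqF.
have : dotp n n <= dotp (n - c *: x) (n - c *: x).
  by rewrite !dotp_norm lerXn2r ?nnegrE.
rewrite !(dotpBl, dotpBr) !(dotpZl, dotpZr) !dotp_norm.
rewrite mulrCA cx opprB addrA subrK -subr_ge0 addrAC subrr add0r oppr_ge0.
rewrite [dotp x n]dotpC /c mulrAC mulrC pmulr_rle0 ?invr_gt0 // -normCK => dx.
apply/eqP; rewrite -normr_eq0 -sqrf_eq0; apply/eqP/le_anti.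
by rewrite dx exprn_ge0.
Qed.

(* The factor [z - z^*] is twice the imaginary part of [z], up to ['i]. *)
Lemma symmetric_lower_bound S z f k : symmetric_op S -> S (f, k) ->
  `|z - z^*| * `|f| <= 2 * `|k - z *: f|.
Proof.
move=> symS Sfk; have [->|f0] := eqVneq f 0.
  by rewrite normr0 mulr0 mulr_ge0.
have nf : 0 < `|f| by rewrite normr_gt0.
rewrite -(ler_pM2r nf) -mulrA -expr2 -dotp_norm.
(* Symmetry gives [(k, f) = (f, k)], so only the [z] terms survive in the difference. *)
have -> : `|z - z^*| * dotp f f = `|dotp f (k - z *: f) - dotp (k - z *: f) f|.
  rewrite -{1}(@ger0_norm _ (dotp f f)) ?dotp_norm ?exprn_ge0 //.
  rewrite -normrM -dotp_norm; congr `| _ |.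
  rewrite dotpBl dotpBr dotpZl dotpZr (symS _ Sfk _ _ Sfk) /=; ring.
apply: (le_trans (ler_normB _ _)).
have -> : 2 * `|k - z *: f| * `|f| = `|f| * `|k - z *: f| + `|k - z *: f| * `|f|.
  by ring.
by rewrite lerD // cauchy_schwarz.
Qed.

(** The defining identity passes to the limit by Cauchy-Schwarz. It supplies closedness of
    self-adjoint operators, where it is not part of the definition. *)
Lemma adjoint_closed S : closed (adjoint S).
Proof.
move=> p clp f h Sfh; apply/eqP; rewrite -subr_eq0 -normr_le0.
apply/ler_addgt0Pr => e e0; rewrite add0r.
(* The summand 1 keeps the divisor positive when [h] and [f] vanish. *)
pose M := `|h| + `|f| + 1.
have M0 : 0 < M by rewrite ltr_wpDl // addr_ge0.
have [|q [adjq [/= q1 q2]]] := clp (ball p.1 (e / M) `*` ball p.2 (e / M)).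
  exists (ball p.1 (e / M), ball p.2 (e / M)) => //=.
  by split; apply: nbhsx_ballx; rewrite divr_gt0.
have -> : dotp h p.1 - dotp f p.2 = dotp h (p.1 - q.1) - dotp f (p.2 - q.2).
  by rewrite !dotpBr (adjq _ _ Sfh); ring.
move: q1 q2; rewrite -!ball_normE /= => /ltW q1 /ltW q2.
apply: (le_trans (ler_normB _ _)).
apply: (@le_trans _ _ (`|h| * (e / M) + `|f| * (e / M))).
  apply: lerD; apply: (le_trans (cauchy_schwarz _ _)); exact: ler_wpM2l.
rewrite -mulrDl mulrCA -[leRHS]mulr1 ler_pM2l // ler_pdivrMr // mul1r.
by rewrite /M lerDl.
Qed.

End HilbertGeometry.

(** * Range of a closed symmetric operator at nonreal points *)

Section Range.
Variables (R : realType) (H : hilbertType R) (S : set (H * H)) (z : R[i]).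
Hypotheses (linS : linear_operator S) (symS : symmetric_op S) (clS : closed S).
Hypothesis znr : z != z^*.
Variable h : H.
Let res (p : H * H) : H := h - (p.2 - z *: p.1).

Let resB p q : res p - res q = (q - p).2 - z *: (q - p).1.
Proof.
by rewrite /res /=; apply: dotp_ext => n; rewrite !dotpl; ring.
Qed.

(** Norms take values in [R[i]], which has no infima, so the infimum is taken over real parts and
    embedded back. *)
Lemma residual_infimum : exists d : R[i],
  (forall p, S p -> d <= `|res p| ^+ 2) /\
  (forall e, 0 < e -> exists2 p, S p & `|res p| ^+ 2 < d + e).
Proof.
pose E := [set complex.Re (`|res p| ^+ 2) | p in S].
have real_res p : `|res p| ^+ 2 = (complex.Re (`|res p| ^+ 2))%:C.
  by rewrite RRe_real // rpredX // normr_real.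
have infE : has_inf E.
  split; first by have [S0 _ _] := linS; exists (complex.Re (`|res (0, 0)| ^+ 2)), (0, 0).
  by exists 0 => _ [p _ <-]; rewrite -lecR -real_res exprn_ge0.
exists (inf E)%:C; split.
  move=> p Sp; rewrite real_res lecR ge_inf //; first by case: infE.
  by exists p.
move=> e e0.
have er : e = (complex.Re e)%:C by rewrite RRe_real // gtr0_real.
have [|_ [p Sp <-] lt] := inf_adherent _ infE (eps := complex.Re e).
  by rewrite -ltcR -er.
by exists p => //; rewrite real_res er -rmorphD ltcR.
Qed.

(** Parallelogram law for the two residuals: their sum is twice the residual at the midpoint, which
    lies in [S] and so has squared norm at least [d]. *)
Lemma residual_gap d e p q : (forall p, S p -> d <= `|res p| ^+ 2) ->
  S p -> S q -> `|res p| ^+ 2 < d + e -> `|res q| ^+ 2 < d + e ->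
  `|(q - p).2 - z *: (q - p).1| ^+ 2 < 4 * e.
Proof.
move=> dmin Sp Sq hp hq; rewrite -resB.
have [S0 linS' _] := linS.
have Sm : S (2^-1 *: p + (2^-1 *: q + 0)).
  exact: (linS' 2^-1 p _ Sp (linS' 2^-1 q _ Sq S0)).
have rm : res p + res q = 2 *: res (2^-1 *: p + (2^-1 *: q + 0)).
  by rewrite /res /=; apply: dotp_ext => n; rewrite !dotpl; field.
have := parallelogram (res p) (res q).
rewrite rm normrZ exprMn ger0_norm // => /(canRL (addKr _)) ->.
have := dmin _ Sm; set r := `|res (_ + _)| ^+ 2 => dr.
have -> : 4 * e = - (2 ^+ 2 * d) + 2 * ((d + e) + (d + e)) by ring.
by rewrite ler_ltD // ?lerN2 ?ler_pM2l ?ltr_pM2l // ltrD.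
Qed.

(* [S] is closed but its range under [S - z I] is not known to be: the lower
   bound turns Cauchy residuals into Cauchy points of the graph itself. *)
Lemma best_approximation : exists2 p, S p &
  forall q, S q -> `|res p| <= `|res q|.
Proof.
have [d [dmin dapx]] := residual_infimum.
pose B (e : R[i]) := [set p | S p /\ `|res p| ^+ 2 < d + e].
(* The filter of near-minimisers; completeness is applied to its two projections. *)
pose F := filter_from [set e : R[i] | 0 < e] B.
have FF : ProperFilter F.
  apply: filter_from_proper; last first.
    by move=> e e0; have [p Sp ltp] := dapx e e0; exists p.
  apply: filter_from_filter; first by exists 1; exact: ltr01.
  move=> e e' /= e0 e'0; exists (Num.min e e').
    by rewrite /= /Num.min; case: ifP.
  move=> p [Sp]; rewrite /Num.min; case: ifPn => // ltee hp.
    by split; split => //; apply: lt_trans hp _; rewrite ltrD2l.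
  split; split=> //; apply: lt_le_trans hp _; rewrite lerD2l.
  by rewrite real_leNgt // gtr0_real.
pose dl := `|z - z^*|.
have dl0 : 0 < dl by rewrite normr_gt0 subr_eq0.
have near_B (t : R[i]) : 0 < t -> exists2 e, 0 < e & forall p q, B e p -> B e q ->
    `|q.1 - p.1| < t /\ `|q.2 - p.2| < t.
  move=> t0.
  (* A residual gap below [s] moves the first component by at most [2 / dl * s] and the second by at
     most [s + |z| * (2 / dl * s)]; [C * s] dominates both. The gap is below [s] when [e = s^2 / 4],
     by the factor 4 in [residual_gap]. *)
  pose C := 1 + 2 / dl * (1 + `|z|).
  have C0 : 0 < C by rewrite ltr_wpDr // mulr_ge0 ?addr_ge0 // divr_ge0 // ltW.
  have [s ts s0] : exists2 s, t = C * s & 0 < s.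
    by exists (t / C); [rewrite mulrC divfK // gt_eqF | rewrite divr_gt0].
  exists (s ^+ 2 / 4); first by rewrite divr_gt0 // exprn_gt0.
  move=> p q [Sp hp] [Sq hq].
  have := residual_gap dmin Sp Sq hp hq; rewrite mulrC divfK ?pnatr_eq0 //.
  rewrite ltr_pXn2r ?nnegrE ?(ltW s0) // => ub.
  have [_ linS' _] := linS.
  have Sqp : S ((q - p).1, (q - p).2).
    by have := linS' (-1) p q Sp Sq; rewrite scaleN1r addrC; case: (q - p).
  have f1 : `|q.1 - p.1| <= 2 / dl * `|(q - p).2 - z *: (q - p).1|.
    have := symmetric_lower_bound z symS Sqp; rewrite -/dl.
    by rewrite mulrAC ler_pdivlMr // mulrC.
  have k1 : `|q.2 - p.2| <= `|(q - p).2 - z *: (q - p).1| + `|z| * `|q.1 - p.1|.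
    rewrite -normrZ; apply: le_trans (ler_normD _ _); rewrite subrK; exact: lexx.
  have z0 : 0 <= 2 / dl by rewrite divr_ge0 // ltW.
  have tC : t = s + 2 / dl * s + `|z| * (2 / dl * s).
    by rewrite ts /C; ring.
  split.
    apply: (le_lt_trans f1); apply: (@le_lt_trans _ _ (2 / dl * s)).
      by rewrite ler_wpM2l // ltW.
    rewrite tC -addrA [ltRHS]addrCA ltrDl ltr_wpDr // mulr_ge0 // mulr_ge0 //.
    exact: ltW.
  apply: (le_lt_trans k1); rewrite tC [ltRHS]addrAC.
  apply: (@lt_le_trans _ _ (s + `|z| * (2 / dl * s))); last first.
    by rewrite lerDl mulr_ge0 // ltW.
  apply: ltr_leD => //; rewrite ler_wpM2l //; apply: (le_trans f1).
  by rewrite ler_wpM2l // ltW.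
have cvg1 : cvg (fst @ F).
  apply: cauchy_cvg; apply: cauchy_exP => t t0.
  have [e e0 Be] := near_B t t0; have [p Sp hp] := dapx e e0.
  exists p.1; exists e => // q Bq; rewrite /= -ball_normE /= distrC.
  by have [] := Be _ _ (conj Sp hp) Bq.
have cvg2 : cvg (snd @ F).
  apply: cauchy_cvg; apply: cauchy_exP => t t0.
  have [e e0 Be] := near_B t t0; have [p Sp hp] := dapx e e0.
  exists p.2; exists e => // q Bq; rewrite /= -ball_normE /= distrC.
  by have [] := Be _ _ (conj Sp hp) Bq.
pose l := (lim (fst @ F), lim (snd @ F)).
have Sl : S l.
  apply: (closed_cvg (F := F) (u_ := id) S) => //.
    by exists 1; [exact: ltr01 | move=> p []].
  suff : (p.1, p.2) @[p --> F] --> l by under eq_fun do rewrite -surjective_pairing.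
  exact: cvg_pair.
exists l => // q Sq; apply/ler_addgt0Pr => e e0.
have e2 : 0 < e / 2 by rewrite divr_gt0.
(* Chosen so that [t + |z| * t = e / 2], the cost of passing from the limit [l] to a near-minimiser
   [p]; the other [e / 2] bounds the excess of [p] over the minimum. *)
pose t := e / 2 / (1 + `|z|).
have z1 : 0 < 1 + `|z| by rewrite ltr_wpDr.
have t0 : 0 < t by rewrite divr_gt0.
have /= /cvg_ballP/(_ _ t0) h1 := cvg1.
have /= /cvg_ballP/(_ _ t0) h2 := cvg2.
have h3 : F (B ((e / 2) ^+ 2)) by exists ((e / 2) ^+ 2) => //=; rewrite exprn_gt0.
have [p [[p1 p2] [Sp hp]]] := filter_ex (filterI (filterI h1 h2) h3).
move: p1 p2; rewrite /= -!ball_normE /= => p1 p2.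
have rp : `|res p| <= `|res q| + e / 2.
  rewrite -(@ler_pXn2r _ 2) ?nnegrE ?addr_ge0 // ?(ltW e2) //.
  apply: (le_trans (ltW hp)); rewrite sqrrD addrAC ler_wpDr //.
    by rewrite mulrn_wge0 // mulr_ge0 // ltW.
  by rewrite lerD2r dmin.
have rl : `|res l| <= `|res p| + e / 2.
  rewrite -lerBlDl; apply: le_trans (lerB_dist _ _) _; rewrite resB /=.
  have -> : e / 2 = t + `|z| * t.
    by rewrite -{1}[t]mul1r -mulrDl [RHS]mulrC divfK // gt_eqF.
  apply: (le_trans (ler_normB _ _)); rewrite distrC lerD ?(ltW p2) //.
  by rewrite normrZ distrC ler_wpM2l // ltW.
by apply: (le_trans rl); rewrite [e in leRHS]splitr addrA lerD2r.
Qed.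

(** The residual of a best approximation is orthogonal to the range of [S - z I], hence an
    eigenvector of the adjoint for the conjugate point. *)
Theorem range_decomposition : exists f k n,
  [/\ S (f, k), adjoint S (n, z^* *: n) & h = k - z *: f + n].
Proof.
have [[f k] Sfk best] := best_approximation.
exists f, k, (res (f, k)); split=> //; last by rewrite addrC subrK.
move=> f' k' Sfk'; rewrite /= dotpZr conjCK -dotpZl; apply/eqP.
rewrite -subr_eq0 -dotpBl; apply/eqP; rewrite dotpC.
rewrite minimal_norm_orthogonal ?conjC0 // => c.
have [_ linS' _] := linS.
have := best _ (linS' c _ _ Sfk' Sfk); congr (_ <= `|_|).
by rewrite /res /=; apply: dotp_ext => n; rewrite !dotpl; ring.
Qed.

End Range.

(** * The rigged space and boundary values *)

Section Rigging.
Variables (R : realType) (H : hilbertType R) (A : symOp H).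
Implicit Types (f g k : Hplus A) (u v : Hminus A) (c : R[i]) (h : H).

Lemma Hplus_valD f g : ((f + g : Hplus A) : H) = (f : H) + (g : H).
Proof. by []. Qed.

Lemma Hplus_valB f g : ((f - g : Hplus A) : H) = (f : H) - (g : H).
Proof. by []. Qed.

Lemma Hplus_valZ c f : ((c *: f : Hplus A) : H) = c *: (f : H).
Proof. by []. Qed.

Lemma astar0 : astar (0 : Hplus A) = 0.
Proof.
by have := astar_linear (-1) (0 : Hplus A) 0; rewrite scaler0 addr0 scaleN1r addNr.
Qed.

Lemma astarD f g : astar (f + g) = astar f + astar g.
Proof. by have := astar_linear 1 f g; rewrite !scale1r. Qed.

Lemma astarZ c f : astar (c *: f) = c *: astar f.
Proof. by have := astar_linear c f 0; rewrite astar0 !addr0. Qed.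

Lemma astarB f g : astar (f - g) = astar f - astar g.
Proof. by rewrite astarD -[- g]scaleN1r astarZ scaleN1r. Qed.

Definition HplusE :=
  (Hplus_valB, Hplus_valD, Hplus_valZ, astarB, astarD, astarZ).

Lemma adjoint_Hplus (h k : H) : adjoint A (h, k) ->
  exists2 f : Hplus A, f = h :> H & astar f = k.
Proof.
move=> hk; have hH : h \in Hplus_pred A by apply/asboolP; exists k.
by exists (HplusMk hH) => //; exact: (adjoint_fun (astarP (HplusMk hH)) hk).
Qed.

Lemma astar_eq f (h : H) : adjoint A (f : H, h) -> astar f = h.
Proof. exact: adjoint_fun (astarP f). Qed.

Lemma dotplusP c f g k : dotplus (c *: f + g) k = c * dotplus f k + dotplus g k.
Proof. by rewrite /dotplus astar_linear !dotpl; ring. Qed.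

Lemma dotplusD f g k : dotplus (f + g) k = dotplus f k + dotplus g k.
Proof. by rewrite /dotplus !HplusE !dotpl; ring. Qed.

Lemma dotplusB f g k : dotplus (f - g) k = dotplus f k - dotplus g k.
Proof. by rewrite /dotplus !HplusE !dotpl; ring. Qed.

Lemma dotplusZ c f k : dotplus (c *: f) k = c * dotplus f k.
Proof. by rewrite /dotplus !HplusE !dotpl; ring. Qed.

Definition dotplusE := (dotplusB, dotplusD, dotplusZ).

Lemma HminusD u v f : (u + v : Hminus A) f = u f + v f.
Proof. by []. Qed.

Lemma HminusB u v f : (u - v : Hminus A) f = u f - v f.
Proof. by []. Qed.

Lemma HminusZ c u f : (c *: u : Hminus A) f = c * u f.
Proof. by []. Qed.

Lemma Hminus0 f : (0 : Hminus A) f = 0.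
Proof. by []. Qed.

Definition HminusE := (HminusB, HminusD, HminusZ, Hminus0).

Lemma Hminus_valD u f g : u (f + g) = u f + u g.
Proof. by have := Hminus_linear u 1 f g; rewrite !scale1r rmorph1 mul1r. Qed.

Lemma Hminus_val0 u : u (0 : Hplus A) = 0.
Proof.
by have := Hminus_linear u (-1) (0 : Hplus A) 0;
  rewrite scaler0 addr0 rmorphN1 mulN1r addNr.
Qed.

Lemma Hminus_valZ u c f : u (c *: f) = c^* * u f.
Proof. by have := Hminus_linear u c f 0; rewrite Hminus_val0 !addr0. Qed.

Lemma embedE h f : embed A h f = dotp h (f : H).
Proof. by []. Qed.

Lemma riesz_invE g f : riesz_inv g f = (dotplus f g)^*.
Proof. by rewrite -dotplusC. Qed.

Lemma one_dimensional_span (V : set H) h : one_dimensional V -> V h -> h != 0 ->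
  V = [set c *: h | c in [set: R[i]]].
Proof.
move=> [g _ ->] [c _ <-] cg0; have c0 : c != 0.
  by apply: contra_neq cg0 => ->; rewrite scale0r.
rewrite seteqP; split=> _ [d _ <-].
  by exists (d / c) => //; rewrite scalerA divfK.
by exists (d * c) => //; rewrite scalerA.
Qed.

End Rigging.

Lemma neqCi_conj (R : realType) : 'i != 'i^* :> R[i].
Proof. by rewrite conjCi -addr_eq0 -mulr2n mulrn_eq0 neq0Ci. Qed.

Lemma neqNCi_conj (R : realType) : - 'i != (- 'i)^* :> R[i].
Proof. by rewrite rmorphN /= eqr_opp neqCi_conj. Qed.

Lemma complex_neq0 (R : realType) (r : R) : 0 < r -> r%:C != 0 :> R[i].
Proof. by move=> r0; rewrite gt_eqF // -[0]/(0%:C) ltcR. Qed.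

Lemma complex1D_neq0 (R : realType) (r : R) : 0 < r -> 1 + r%:C != 0 :> R[i].
Proof.
by move=> r0; rewrite -(rmorph1 (real_complex R)) -rmorphD complex_neq0 // addr_gt0.
Qed.

Definition deficiency_basis (R : realType) (H : hilbertType R) (A : symOp H)
    (gp gm : Hplus A) :=
  [/\ deficiency_indices_11 A, defect_space A 'i gp, defect_space A (- 'i) gm,
      normplus gp = 1 & normplus gm = 1].

(** * Boundary coordinates and von Neumann's decomposition *)

Section Boundary.
Variables (R : realType) (H : hilbertType R) (A : symOp H) (gp gm : Hplus A).
Hypothesis basis : deficiency_basis gp gm.
Implicit Types (f g k : Hplus A) (u v : Hminus A) (c z : R[i]) (h : H).

Notation cp f := (dotplus f gp).
Notation cm f := (dotplus f gm).
Notation phi := (riesz_inv gp).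
Notation psi := (riesz_inv gm).

Let defA : deficiency_indices_11 A. Proof. by case: basis. Qed.
Let Ngp : defect_space A 'i gp. Proof. by case: basis. Qed.
Let Ngm : defect_space A (- 'i) gm. Proof. by case: basis. Qed.
Let gp1 : normplus gp = 1. Proof. by case: basis. Qed.
Let gm1 : normplus gm = 1. Proof. by case: basis. Qed.

Lemma astar_gp : astar gp = 'i *: (gp : H).
Proof. exact: astar_eq. Qed.

Lemma astar_gm : astar gm = - 'i *: (gm : H).
Proof. exact: astar_eq. Qed.

Lemma cpE f : cp f = dotp (f : H) gp - 'i * dotp (astar f) gp.
Proof. by rewrite /dotplus astar_gp dotpZr conjCi mulNr. Qed.

Lemma cmE f : cm f = dotp (f : H) gm + 'i * dotp (astar f) gm.
Proof. by rewrite /dotplus astar_gm dotpZr rmorphN /= conjCi opprK. Qed.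

Lemma cp_gp : cp gp = 1.
Proof. by rewrite -[LHS]sqrtCK -/(normplus gp) gp1 expr1n. Qed.

Lemma cm_gm : cm gm = 1.
Proof. by rewrite -[LHS]sqrtCK -/(normplus gm) gm1 expr1n. Qed.

(** The eigenvalues [i] and [-i] make the two terms of the (+)-product cancel, so the deficiency
    vectors are (+)-orthogonal. *)
Lemma cp_gm : cp gm = 0.
Proof. by rewrite cpE astar_gm dotpZl; ring: (mulCii R[i]). Qed.

Lemma cm_gp : cm gp = 0.
Proof. by rewrite cmE astar_gp dotpZl; ring: (mulCii R[i]). Qed.

Lemma gp_neq0 : (gp : H) != 0.
Proof.
apply/eqP => g0; have /eqP := cp_gp.
by rewrite /dotplus astar_gp g0 scaler0 !dotp0l addr0 eq_sym oner_eq0.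
Qed.

Lemma gm_neq0 : (gm : H) != 0.
Proof.
apply/eqP => g0; have /eqP := cm_gm.
by rewrite /dotplus astar_gm g0 scaler0 !dotp0l addr0 eq_sym oner_eq0.
Qed.

(** On an eigenvector of [A^*] for [i] both terms of the (+)-norm coincide, whence the factor
    [sqrt 2] between the two normalizations. *)
Lemma dotp_gp : dotp (gp : H) gp = 2^-1.
Proof.
have := cp_gp; rewrite cpE astar_gp dotpZl => e.
apply: (mulfI (x := 2)); first by rewrite pnatr_eq0.
by rewrite mulfV ?pnatr_eq0 // -[RHS]e; ring: (mulCii R[i]).
Qed.

Lemma defect_gp f : astar f = 'i *: (f : H) -> exists c, f = c *: gp.
Proof.
move=> fi; have : defect_space A 'i f by rewrite /defect_space /= -fi; exact: astarP.
rewrite (one_dimensional_span defA.1 Ngp gp_neq0) => -[c _ cg].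
by exists c; apply: val_inj.
Qed.

Lemma defect_gm f : astar f = - 'i *: (f : H) -> exists c, f = c *: gm.
Proof.
move=> fi; have : defect_space A (- 'i) f by rewrite /defect_space /= -fi; exact: astarP.
rewrite (one_dimensional_span defA.2 Ngm gm_neq0) => -[c _ cg].
by exists c; apply: val_inj.
Qed.

Lemma cp_dom f : graph A (f : H, astar f) -> cp f = 0.
Proof.
by move=> Af; rewrite cpE (Ngp Af) dotpZr conjCi; ring: (mulCii R[i]).
Qed.

Lemma cm_dom f : graph A (f : H, astar f) -> cm f = 0.
Proof.
by move=> Af; rewrite cmE (Ngm Af) dotpZr rmorphN /= conjCi; ring: (mulCii R[i]).
Qed.

(** Split [(A^* + i) f] as [(A + i) f0 + n] with [n] in [Ker(A^* - i)]. Removing [f0] and the right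
    multiple of [gp] leaves an element of [Ker(A^* + i)]; (+)-orthonormality identifies the
    coefficients. *)
Theorem von_neumann_decomposition f : exists2 f0 : Hplus A,
  graph A (f0 : H, astar f0) & f = f0 + cp f *: gp + cm f *: gm.
Proof.
have [f' [k [n [Af' Nn fE]]]] := range_decomposition (symOp_linear A)
  (@symOp_symmetric _ _ A) (@symOp_closed _ _ A) (neqNCi_conj R)
  (astar f + 'i *: (f : H)).
have [f0 f0E f0k] := adjoint_Hplus (symOp_symmetric Af').
have [n' n'E n'k] := adjoint_Hplus Nn.
move: n'k; rewrite -n'E rmorphN /= conjCi opprK => /defect_gp [c nc].
(* [A^* + i] multiplies [gp] by [2i], which explains the denominator. *)
have [|d dE] := @defect_gm (f - f0 - (c / (2 * 'i)) *: gp).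
  rewrite !HplusE f0k astar_gp; move: fE; rewrite -n'E nc -f0E !HplusE => fE.
  apply: dotp_ext => x; move/(congr1 (dotp^~ x)): fE.
  rewrite !dotpl => /(canRL (addrK _)) ->.
  by field: (mulCii R[i]); rewrite neq0Ci.
have fE' : f = f0 + (c / (2 * 'i)) *: gp + d *: gm.
  by rewrite -dE -[f - f0 - _]addrA -opprD [RHS]addrC subrK.
have A0 : graph A (f0 : H, astar f0) by rewrite f0E f0k.
exists f0 => //; rewrite {1}fE' fE' !dotplusE (cp_dom A0) (cm_dom A0).
by rewrite cp_gp cp_gm cm_gp cm_gm !mulr1 !mulr0 !addr0 !add0r.
Qed.

(** Only [f] is decomposed: its part in the domain of [A] cancels by the definition of the adjoint,
    and pairing [k] with [gp] and [gm] reproduces [cpE] and [cmE]. *)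
Lemma green f k : dotp (astar f) (k : H) - dotp (f : H) (astar k)
  = 'i * (cp f * (cp k)^* - cm f * (cm k)^*).
Proof.
have [f0 A0 {1 2}->] := von_neumann_decomposition f.
rewrite !HplusE !dotpl astar_gp astar_gm !dotpl (astarP k A0) /=.
rewrite (cpE k) (cmE k) !(rmorphB, rmorphD, rmorphM) /= conjCi -!dotpC.
ring: (mulCii R[i]).
Qed.

(** The annihilator of the domain of [A] in H_- is two-dimensional; this puts channel vectors and
    deviations from [A^*] in the span of [phi] and [psi]. *)
Lemma Hminus_boundary u : (forall f, graph A (f : H, astar f) -> u f = 0) ->
  u = u gp *: phi + u gm *: psi.
Proof.
move=> u0; apply: HminusP => f; have [f0 A0 fE] := von_neumann_decomposition f.
rewrite [in LHS]fE !Hminus_valD !Hminus_valZ (u0 _ A0) add0r.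
by rewrite !HminusE !riesz_invE mulrC [X in _ + X]mulrC.
Qed.

Lemma embedB h (l : H) : embed A (h - l) = embed A h - embed A l.
Proof. by apply: HminusP => f; rewrite HminusE !embedE dotpBl. Qed.

Lemma embedZ c h : embed A (c *: h) = c *: embed A h.
Proof. by apply: HminusP => f; rewrite HminusE !embedE dotpZl. Qed.

(** [phi] and [psi] vanish on the dense domain of [A], which forces [h = 0]; testing on [gp] and
    [gm] then kills [c] and [d]. *)
Let embed_boundary_eq0 h c d : embed A h + c *: phi + d *: psi = 0 ->
  [/\ h = 0, c = 0 & d = 0].
Proof.
move=> e; have ef f : dotp h (f : H) + c * (cp f)^* + d * (cm f)^* = 0.
  by have := congr1 (fun u : Hminus A => u f) e; rewrite !HminusE embedE !riesz_invE.
have h0 : h = 0.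
  apply: (dense_orthogonal (symOp_dense A)) => x [y Axy].
  have [f fx fy] := adjoint_Hplus (symOp_symmetric Axy).
  have Af : graph A (f : H, astar f) by rewrite fx fy.
  have := ef f; rewrite (cp_dom Af) (cm_dom Af) conjC0 !mulr0 !addr0 fx => hx.
  by rewrite dotpC hx conjC0.
split=> //.
  by have := ef gp; rewrite h0 dotp0l cp_gp cm_gp conjC0 conjC1 add0r mulr0 addr0 mulr1.
by have := ef gm; rewrite h0 dotp0l cp_gm cm_gm conjC0 conjC1 add0r mulr0 add0r mulr1.
Qed.

Lemma embed_boundary_inj h (l : H) c d c' d' :
  embed A h + c *: phi + d *: psi = embed A l + c' *: phi + d' *: psi ->
  [/\ h = l, c = c' & d = d'].
Proof.
move=> e; have [] := @embed_boundary_eq0 (h - l) (c - c') (d - d').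
  apply: HminusP => f; move/(congr1 (fun u : Hminus A => u f)): e.
  rewrite embedB !HminusE => /eqP; rewrite -subr_eq0 => /eqP e.
  by rewrite -[RHS]e; ring.
by move=> /eqP + /eqP + /eqP; rewrite !subr_eq0 => /eqP -> /eqP -> /eqP ->.
Qed.

End Boundary.

(** * Resolvents of self-adjoint operators *)

Lemma derivable_quadratic (R : realType) (F : R[i]^o -> R[i]^o) (z l C e : R[i]) :
  0 < e -> 0 <= C ->
  (forall t, `|t| < e -> `|F (z + t) - F z - t * l| <= C * `|t| ^+ 2) ->
  derivable F z 1.
Proof.
move=> e0 C0 dF; apply: (cvgP (l : R[i]^o)); apply/cvgrPdist_le => r r0.
(* [C] may be zero; [C + 1] can be divided by. *)
have C1 : 0 < C + 1 by rewrite ltr_wpDl.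
near=> t.
have t0 : t != 0 by near: t; exact: nbhs_dnbhs_neq.
have nt : 0 < `|t| by rewrite normr_gt0.
have te : `|t| < e by near: t; exact: dnbhs0_lt.
have tr : `|t| < r / (C + 1) by near: t; apply: dnbhs0_lt; rewrite divr_gt0.
have /= := dF _ te; rewrite /= -[t in F (z + t)]mulr1 => le.
rewrite distrC -(ler_pM2l nt) -normrM.
have -> : t * (t^-1 *: (F (t *: 1 + z) - F z) - l) = F (z + t * 1) - F z - t * l.
  by rewrite mulrBr /GRing.scale /= mulVKf // [t * 1 + z]addrC.
apply: (le_trans le); rewrite expr2 mulrCA ler_pM2l //.
apply: (@le_trans _ _ ((C + 1) * `|t|)); first by rewrite ler_pM2r // lerDl.
by rewrite mulrC -ler_pdivlMr // ltW.
Unshelve. all: by end_near.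
Qed.

Section SelfadjointResolvent.
Variables (R : realType) (H : hilbertType R) (S : set (H * H)).
Hypotheses (linS : linear_operator S) (saS : selfadjoint_op S).
Implicit Types (z w : R[i]) (f h : H).

Let symS : symmetric_op S. Proof. by rewrite /symmetric_op -saS. Qed.
Let clS : closed S. Proof. by rewrite saS; exact: adjoint_closed. Qed.

Lemma resolvent_uniq z h f f' : z != z^* ->
  S (f, h + z *: f) -> S (f', h + z *: f') -> f = f'.
Proof.
move=> znr Sf Sf'; have [_ lin _] := linS.
have := lin (-1) _ _ Sf' Sf; rewrite !scaleN1r => Sd.
have := symmetric_lower_bound z symS Sd.
have -> : - (h + z *: f') + (h + z *: f) - z *: (- f' + f) = 0.
  by apply: dotp_ext => x; rewrite !dotpl; ring.
rewrite normr0 mulr0 pmulr_rle0 ?normr_gt0 ?subr_eq0 // normr_le0.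
by rewrite addrC subr_eq0 => /eqP.
Qed.

(** The range of [S - z I] is everything: the orthogonal component is an eigenvector of [S] itself,
    by self-adjointness, for a nonreal number, so the lower bound makes it zero. *)
Lemma resolventP z h : z != z^* ->
  S (resolvent S z h, h + z *: resolvent S z h).
Proof.
move=> znr.
have [f [k [n [Sf Sn hE]]]] := range_decomposition linS symS clS znr h.
have Sn' : S (n, z^* *: n) by rewrite saS.
have n0 : n = 0.
  have := symmetric_lower_bound z^* symS Sn'.
  rewrite subrr normr0 mulr0 pmulr_rle0 ?normr_gt0; first by rewrite normr_le0 => /eqP.
  by rewrite conjCK subr_eq0 eq_sym.
apply: (@xgetI _ 0 [set f | S (f, h + z *: f)] f) => /=.
by rewrite hE n0 addr0 subrK.
Qed.

Lemma resolvent_eq z h f : z != z^* -> S (f, h + z *: f) -> resolvent S z h = f.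
Proof. by move=> znr Sf; exact: (resolvent_uniq znr (resolventP h znr)). Qed.

Lemma resolvent_bound z h : z != z^* -> `|z - z^*| * `|resolvent S z h| <= 2 * `|h|.
Proof.
move=> znr; have := symmetric_lower_bound z symS (resolventP h znr).
by rewrite addrK.
Qed.

Lemma resolvent_identity z w h : z != z^* -> w != w^* ->
  resolvent S w h = resolvent S z h + (w - z) *: resolvent S w (resolvent S z h).
Proof.
move=> znr wnr; set f := resolvent S z h; apply: resolvent_eq => //.
have [_ lin _] := linS.
have := lin (w - z) _ _ (resolventP f wnr) (resolventP h znr); rewrite -/f.
congr (S (_, _)) => /=; first by rewrite addrC.
by apply: dotp_ext => x; rewrite !dotpl; ring.
Qed.

(* Iterating the resolvent identity once exhibits the quadratic remainder. *)
Lemma derivable_resolvent g z : z != z^* ->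
  derivable ((fun w => dotp (resolvent S w g) g) : R[i]^o -> R[i]^o) z 1.
Proof.
move=> znr; set e := `|z - z^*| / 4.
have d0 : 0 < `|z - z^*| by rewrite normr_gt0 subr_eq0.
have e0 : 0 < e by rewrite divr_gt0.
set y := resolvent S z (resolvent S z g).
apply: (@derivable_quadratic _ _ z (dotp y g) (4 * `|y| * `|g| / `|z - z^*|) e) => //.
move=> t te.
(* A shift by less than a quarter of [|z - z^*|] at most halves it, which bounds the resolvent
   uniformly near [z]. *)
have half : `|z - z^*| / 2 <= `|(z + t) - (z + t)^*|.
  have -> : z + t - (z + t)^* = (z - z^*) + (t - t^*) by rewrite rmorphD /=; ring.
  apply: le_trans (lerB_normD _ _); rewrite lerBrDr -lerBrDl.
  apply: (le_trans (ler_normB _ _)); rewrite norm_conjC.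
  have -> : `|z - z^*| - `|z - z^*| / 2 = e + e by rewrite /e; field.
  by rewrite lerD // ltW.
have wnr : z + t != (z + t)^*.
  by rewrite -subr_eq0 -normr_gt0; apply: lt_le_trans half; rewrite divr_gt0.
(* Here [y] is the squared resolvent at [z] applied to [g], so [(y, g)] is the derivative. *)
have -> : dotp (resolvent S (z + t) g) g - dotp (resolvent S z g) g - t * dotp y g
    = t ^+ 2 * dotp (resolvent S (z + t) y) g.
  rewrite (resolvent_identity g znr wnr).
  rewrite (resolvent_identity (resolvent S z g) znr wnr) -/y.
  by rewrite !dotpl; ring.
rewrite normrM normrX mulrC ler_wpM2r ?exprn_ge0 //.
apply: (le_trans (cauchy_schwarz _ _)).
rewrite [leRHS]mulrAC; apply: ler_wpM2r => //.
rewrite ler_pdivlMr // mulrC.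
have := resolvent_bound y wnr.
move/(le_trans (ler_wpM2r (normr_ge0 _) half)) => b.
rewrite -(ler_pM2l (ltr0Sn _ 1)) in b.
rewrite (_ : `|z - z^*| * _ = 2 * (`|z - z^*| / 2 * `|resolvent S (z + t) y|)).
  by rewrite (_ : 4 * _ = 2 * (2 * `|y|)) //; ring.
by field.
Qed.

End SelfadjointResolvent.

Lemma Im_neq0 (R : realType) (z : R[i]) : (complex.Im z != 0) = (z != z^*).
Proof.
case: z => x y; congr (~~ _).
by rewrite eq_complex /= eqxx /= -addr_eq0 -mulr2n mulrn_eq0.
Qed.

(** * Bi-extensions as boundary matrices *)

Section BoundaryMatrix.
Variables (R : realType) (H : hilbertType R) (A : symOp H) (gp gm : Hplus A).
Hypothesis basis : deficiency_basis gp gm.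
Implicit Types (f g k : Hplus A) (u v : Hminus A) (h : H) (B : biop A).
Implicit Types (a b c d x y z : R[i]).

Notation cp f := (dotplus f gp).
Notation cm f := (dotplus f gm).
Notation phi := (riesz_inv gp).
Notation psi := (riesz_inv gm).

Lemma biopP B (C : biop A) : (forall f g, B f g = C f g) -> B = C.
Proof.
by move=> BC; apply: val_inj; apply/funext => f; apply: HminusP => g; exact: BC.
Qed.

Lemma biopD B (C : biop A) f : (B + C : biop A) f = B f + C f.
Proof. by []. Qed.

Lemma biopB B (C : biop A) f : (B - C : biop A) f = B f - C f.
Proof. by []. Qed.

Lemma biopZ (c : R[i]) B f : (c *: B : biop A) f = c *: B f.
Proof. by []. Qed.

Lemma biadjE B f g : biadj B f g = (B g f)^*.
Proof. by []. Qed.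

Definition biopE := (biopB, biopD, biopZ).

Lemma bi_re_adj B : biadj (bi_re B) = bi_re B.
Proof.
apply: biopP => f g.
rewrite biadjE /bi_re !biopE !HminusE !biadjE rmorphM rmorphD /= conjCK.
by rewrite addrC fmorphV /= conjC_nat.
Qed.

Definition boundary_matrix B a b c d := forall f,
  B f = embed A (astar f) + (a * cp f + b * cm f) *: phi
                          + (c * cp f + d * cm f) *: psi.

Lemma boundary_matrix_eq B a b c d a' b' c' d' : boundary_matrix B a b c d ->
  a = a' -> b = b' -> c = c' -> d = d' -> boundary_matrix B a' b' c' d'.
Proof. by move=> mB <- <- <- <-. Qed.

Lemma boundary_matrixE B a b c d f k : boundary_matrix B a b c d ->
  B f k = dotp (astar f) (k : H) + (a * cp f + b * cm f) * (cp k)^*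
                                 + (c * cp f + d * cm f) * (cm k)^*.
Proof. by move=> ->; rewrite !HminusE !riesz_invE embedE. Qed.

Lemma boundary_matrixP B a b c d :
  (forall f k, B f k = dotp (astar f) (k : H) + (a * cp f + b * cm f) * (cp k)^*
                                 + (c * cp f + d * cm f) * (cm k)^*) ->
  boundary_matrix B a b c d.
Proof.
by move=> e f; apply: HminusP => k; rewrite e !HminusE !riesz_invE embedE.
Qed.

Lemma bi_extends_dom B f : bi_extends A B -> graph A (f : H, astar f) ->
  B f = embed A (astar f).
Proof. by move=> AB /AB [k kf <-]; congr (B _); apply: val_inj. Qed.

(** Let [D = B - A^*]. That [B] extends [A] makes [D f] depend only on the boundary coordinates of
    [f]; that the adjoint of [B] extends [A] makes each [D f] vanish on the domain of [A], hence lie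
    in the span of [phi] and [psi]. *)
Lemma bi_extension_boundary_matrix B :
  bi_extends A B -> bi_extends A (biadj B) ->
  exists a b c d, boundary_matrix B a b c d.
Proof.
move=> AB AB'.
pose D f := B f - embed A (astar f).
have Dvan f k : graph A (k : H, astar k) -> D f k = 0.
  move=> Ak; rewrite HminusE biadjP /pairing (bi_extends_dom AB' Ak) !embedE.
  by rewrite (astarP f Ak) -dotpC subrr.
have Dext f : B f = embed A (astar f) + D f gp *: phi + D f gm *: psi.
  by rewrite -addrA -(Hminus_boundary basis (Dvan f)) addrC subrK.
have Dlin c f g : D (c *: f + g) = c *: D f + D g.
  apply: HminusP => k.
  by rewrite /D !HminusE biop_linear !HminusE !embedE astar_linear !dotpl; ring.
exists (D gp gp), (D gm gp), (D gp gm), (D gm gm) => f.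
have Df : D f = cp f *: D gp + cm f *: D gm.
  have [f0 A0 {1}->] := von_neumann_decomposition basis f.
  rewrite -addrA addrC -addrA !Dlin; congr (_ + _).
  by rewrite /D (bi_extends_dom AB A0) subrr addr0.
by rewrite Dext Df !HminusE; congr (_ + _ *: _ + _ *: _); ring.
Qed.

(** The conjugate transpose, corrected on the diagonal by the boundary form of Green's formula
    because [A^*] is not symmetric. *)
Lemma boundary_matrix_biadj B a b c d : boundary_matrix B a b c d ->
  boundary_matrix (biadj B) (a^* - 'i) c^* b^* (d^* + 'i).
Proof.
move=> mB; apply: boundary_matrixP => f k.
have := green basis f k => /(canRL (subrK _)) ->.
rewrite biadjE (boundary_matrixE _ _ mB).
move: (cp f) (cm f) (cp k) (cm k) => p q p' q'.
by rewrite !(rmorphD, rmorphM) /= !conjCK -dotpC; ring.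
Qed.

Lemma boundary_matrix_re B a b c d : boundary_matrix B a b c d ->
  boundary_matrix (bi_re B) ((a + a^* - 'i) / 2) ((b + c^*) / 2)
                            ((c + b^*) / 2) ((d + d^* + 'i) / 2).
Proof.
move=> mB; apply: boundary_matrixP => f k.
rewrite /bi_re !biopE !HminusE (boundary_matrixE _ _ mB).
by rewrite (boundary_matrixE _ _ (boundary_matrix_biadj mB)); field.
Qed.

Lemma boundary_matrix_im B a b c d f : boundary_matrix B a b c d ->
  bi_im B f = (2 * 'i)^-1 *:
    (((a - a^* + 'i) * cp f + (b - c^*) * cm f) *: phi
     + ((c - b^*) * cp f + (d - d^* - 'i) * cm f) *: psi).
Proof.
move=> mB; apply: HminusP => k.
rewrite /bi_im !biopE !HminusE (boundary_matrixE _ _ mB) !riesz_invE.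
by rewrite (boundary_matrixE _ _ (boundary_matrix_biadj mB)); ring.
Qed.

(** Since H meets the span of [phi] and [psi] only in 0, quasi-kernels and extension relations
    become two scalar equations. *)
Lemma boundary_matrix_embed B a b c d f h : boundary_matrix B a b c d ->
  B f = embed A h <->
  [/\ h = astar f, a * cp f + b * cm f = 0 & c * cp f + d * cm f = 0].
Proof.
move=> mB; split=> [|[-> e1 e2]]; last by rewrite mB e1 e2 !scale0r !addr0.
rewrite mB => e; have [|-> -> ->] // := @embed_boundary_inj _ _ _ _ _ basis
  (astar f) h (a * cp f + b * cm f) (c * cp f + d * cm f) 0 0.
by rewrite e !scale0r !addr0.
Qed.

Lemma boundary_matrix_solve B a b c d z f x y : boundary_matrix B a b c d ->
  B f - z *: embed A (f : H) = x *: phi + y *: psi <->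
  [/\ astar f = z *: (f : H), a * cp f + b * cm f = x & c * cp f + d * cm f = y].
Proof.
move=> mB; split=> [e|[e1 e2 e3]].
  apply: (embed_boundary_inj basis); apply: HminusP => k.
  move/(congr1 (fun u : Hminus A => u k)): e; rewrite mB embedZ !HminusE => e.
  apply/eqP; rewrite -subr_eq0; apply/eqP; move/eqP: e.
  by rewrite -subr_eq0 => /eqP <-; ring.
by apply: HminusP => k; rewrite mB e1 e2 e3 embedZ !HminusE; ring.
Qed.

(** [bi_resolvent] chooses a solution, with a default value, so its value is determined only once
    the solution is shown to be unique; hence the equivalence. *)
Lemma bi_resolvent_eq B a b c d z f x y : boundary_matrix B a b c d ->
  (forall g, [/\ astar g = z *: (g : H), a * cp g + b * cm g = x
     & c * cp g + d * cm g = y] <-> g = f) ->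
  bi_resolvent B z (x *: phi + y *: psi) = f.
Proof.
move=> mB sol; apply: xget_unique => [|g].
  by apply/(boundary_matrix_solve _ _ _ _ mB)/sol.
by move/(boundary_matrix_solve _ _ _ _ mB)/sol.
Qed.

End BoundaryMatrix.

(** * The self-adjoint extension in boundary coordinates *)

Section SelfadjointExtension.
Variables (R : realType) (H : hilbertType R) (dotA : symOp H).
Variables (gp gm : Hplus dotA) (A : set (H * H)).
Hypothesis basis : deficiency_basis gp gm.
Hypotheses (dotA_A : dotA `<=` A) (saA : selfadjoint_op A).
Hypothesis domA : opdom A ((gp : H) - (gm : H)).
Implicit Types (f g k : Hplus dotA) (h : H) (z : R[i]).

Notation cp f := (dotplus f gp).
Notation cm f := (dotplus f gm).

Lemma selfadjoint_extension_adjoint p : A p -> adjoint dotA p.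
Proof. by rewrite saA => Ap f h /dotA_A; exact: Ap. Qed.

Lemma selfadjoint_extension_linear : linear_operator A.
Proof.
split=> [|c p q|h].
- by rewrite saA => f h _; rewrite !dotp0r.
- by rewrite saA; exact: adjoint_linear.
move/selfadjoint_extension_adjoint => A0h; apply: (adjoint_fun A0h).
by move=> f h' _; rewrite !dotp0r.
Qed.

(** Green's formula against [gp - gm], itself in the domain of the symmetric operator [A], yields
    the equation. Conversely the equation makes [f] a multiple of [gp - gm] modulo the domain of
    [dotA]. *)
Lemma selfadjoint_extension_dom f : A (f : H, astar f) <-> cp f + cm f = 0.
Proof.
have [l Al] := domA.
have Ad : A ((gp - gm : Hplus dotA) : H, astar (gp - gm)).
  by rewrite (@astar_eq _ _ _ (gp - gm) l (selfadjoint_extension_adjoint Al)).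
split=> [Af|e].
  have := green basis f (gp - gm); rewrite saA in Ad; rewrite (Ad _ _ Af) subrr.
  rewrite !dotplusE (cp_gp basis) (cp_gm basis) (cm_gp basis) (cm_gm basis).
  rewrite subr0 sub0r rmorphN1 conjC1 mulr1 mulrN1 opprK => /eqP.
  by rewrite eq_sym mulf_eq0 (negPf (neq0Ci _)) => /eqP.
have [f0 A0 fE] := von_neumann_decomposition basis f.
have {}fE : f = cp f *: (gp - gm) + f0.
  have q : cm f = - cp f by rewrite -[LHS](addKr (cp f)) e addr0.
  by rewrite [LHS]fE q scalerBr scaleNr -addrA addrC.
have [_ lin _] := selfadjoint_extension_linear.
have := lin (cp f) _ _ Ad (dotA_A A0).
by rewrite {2 3}fE astar_linear.
Qed.

End SelfadjointExtension.

Lemma opval_eq (R : realType) (H : hilbertType R) (T : set (H * H)) (f h : H) :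
  linear_operator T -> T (f, h) -> opval T f = h.
Proof.
move=> [_ lin T0] Tfh; apply: xget_unique => //= k Tfk.
have := lin (-1) _ _ Tfk Tfh; rewrite /= !scaleN1r => Td.
apply/esym/eqP; rewrite -subr_eq0 addrC; apply/eqP; apply: T0.
by rewrite -[X in T (X, _)](addNr f).
Qed.

Lemma weyl_titchmarsh_resolvent (R : realType) (H : hilbertType R)
    (A : set (H * H)) (g : H) (z : R[i]) :
  linear_operator A -> selfadjoint_op A -> `|g| = 1 -> z != z^* ->
  weyl_titchmarsh A g z = z + (z ^+ 2 + 1) * dotp (resolvent A z g) g.
Proof.
move=> linA saA g1 znr; rewrite /weyl_titchmarsh.
rewrite (opval_eq linA (resolventP linA saA g znr)) !dotpl.
by rewrite dotp_norm g1; ring.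
Qed.

Lemma transfer_c_entropy (R : realType) (H : hilbertType R) (A : symOp H)
    (Theta : Lsystem A) (a : R) : 0 < a < 1 ->
  transfer Theta (- 'i) = ((1 - a) / (1 + a))%:C ->
  c_entropy Theta = (ln (1 + a) - ln (1 - a))%:E.
Proof.
move=> /andP[a0 a1] W.
have b0 : 0 < 1 - a by rewrite subr_gt0.
have c0 : 0 < 1 + a by rewrite addr_gt0.
have q0 : 0 < (1 - a) / (1 + a) by rewrite divr_gt0.
rewrite /c_entropy W gt_eqF; last by rewrite -[0]/(0%:C) ltcR.
rewrite /= expr0n addr0 sqrtr_sqr ger0_norm ?ltW //.
by rewrite ln_div ?posrE // opprB.
Qed.

(** * Main operator and coefficient of dissipation *)

Section MainOperator.
Variables (R : realType) (H : hilbertType R) (A : symOp H) (gp gm : Hplus A).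
Hypothesis basis : deficiency_basis gp gm.
Implicit Types (T : set (H * H)) (f g k : Hplus A) (a : R).

Notation cp f := (dotplus f gp).
Notation cm f := (dotplus f gm).
Notation phi := (riesz_inv gp).
Notation psi := (riesz_inv gm).

(** On the line [p + q = 0] the boundary form of Green's formula vanishes, so an operator contained
    in it would be symmetric. *)
Lemma nonsymmetric_coef T : T `<=` adjoint A -> ~ symmetric_op T ->
  exists2 f : Hplus A, T (f : H, astar f) & cp f + cm f != 0.
Proof.
move=> TA; apply: contra_notP => nf [k l] Tkl f h Tfh /=.
have [F Ff Fh] := adjoint_Hplus (TA _ Tfh).
have [K Kk Kl] := adjoint_Hplus (TA _ Tkl).
have TF : T (F : H, astar F) by rewrite Ff Fh.
have TK : T (K : H, astar K) by rewrite Kk Kl.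
have coef0 (G : Hplus A) : T (G : H, astar G) -> cm G = - cp G.
  move=> TG; apply/eqP; rewrite -addr_eq0 addrC.
  by apply/negPn/negP => ne; apply: nf; exists G.
apply/eqP; rewrite -subr_eq0 -Ff -Fh -Kk -Kl (green basis) !coef0 // rmorphN.
by rewrite /= mulrNN subrr mulr0.
Qed.

Lemma main_operator_dissipation T a : 0 < a < 1 ->
  linear_operator T -> A `<=` T -> T `<=` adjoint A ->
  (exists f : Hplus A, [/\ T (f : H, astar f), cp f + cm f != 0 &
                 (1 - a)%:C * cp f + (1 + a)%:C * cm f = 0]) ->
  dissipation_coefficient T gp gm (4 * a / (1 + a) ^+ 2).
Proof.
move=> /andP[a0 a1] linT AT TA [f [Tf pq0 e]].
have c0 : 0 < 1 + a by rewrite addr_gt0.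
(* Read off from the linear equation, which says [q = - kappa * p]. *)
pose kappa := (1 - a) / (1 + a).
exists kappa.
  rewrite divr_ge0 ?ltW ?subr_gt0 //= ltr_pdivrMr // mul1r.
  by rewrite ltrD2l gtrN.
pose s := (Num.sqrt 2 : R)%:C.
pose y : Hplus A := s *: (gp - kappa%:C *: gm).
have -> : s *: (gp : H) - kappa%:C *: (s *: (gm : H)) = (y : H).
  by apply: dotp_ext => x; rewrite /y !HplusE !dotpl; ring.
have cC0 : (1 + a)%:C != 0 by exact: complex_neq0.
have q : cm f = - kappa%:C * cp f.
  apply: (mulfI cC0); move/eqP: e; rewrite addrC addr_eq0 => /eqP ->.
  rewrite /kappa rmorphM fmorphV /=.
  by move: (1 + a)%:C (1 - a)%:C cC0 => u v u0; field.
have p0 : cp f != 0.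
  by apply: contra_neq pq0 => p0; rewrite q p0 mulr0 addr0.
have [f0 A0 fE] := von_neumann_decomposition basis f.
(* Modulo the domain of [A], [y] is a multiple of [f], hence in the domain of [T]. *)
have yE : y = (s / cp f) *: (f - f0).
  have -> : f - f0 = cp f *: (gp - kappa%:C *: gm).
    rewrite {1}fE q -[f0 + _ + _]addrA [LHS]addrC addKr.
    by rewrite scalerBr scalerA mulNr scaleNr [cp f * _]mulrC.
  by rewrite scalerA divfK.
have Ty : T (y : H, astar y).
  have [T0 lin _] := linT.
  have := lin (s / cp f) _ _ (lin (-1) _ _ (AT _ A0) Tf) T0.
  rewrite yE !HplusE; congr (T (_, _)); rewrite /= addr0 scaleN1r.
    by rewrite [- _ + _]addrC.
  by rewrite [- _ + _]addrC.
split; first by exists (astar y).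
rewrite (opval_eq linT Ty); apply: complexI.
(* Green's formula on the pair [(y, y)] expresses twice the imaginary part as
   [2 * (1 - kappa^2)]. *)
have gy := green basis y y; rewrite [X in _ - X]dotpC in gy.
have ss : s * s^* = 2.
  rewrite (_ : s^* = s); last exact: conjc_real.
  by rewrite /s -rmorphM /= -expr2 sqr_sqrtr // rmorph_nat.
have cpy : cp y = s by rewrite !dotplusE (cp_gp basis) (cp_gm basis); ring.
have cmy : cm y = - kappa%:C * s.
  by rewrite !dotplusE (cm_gp basis) (cm_gm basis); ring.
have := subcJ (dotp (astar y) y); rewrite gy cpy cmy => im.
have i0 : 'i != 0 :> R[i] := neq0Ci _.
have kr : (kappa%:C)^* = kappa%:C :> R[i] := conjc_real kappa.
have ks : (- kappa%:C * s)^* = - kappa%:C * s^*.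
  by rewrite (rmorphM Num.conj) (rmorphN Num.conj) [X in - X * _]kr.
rewrite ks in im.
apply: (mulfI (x := 2 * 'i)); first by rewrite mulf_neq0 ?pnatr_eq0.
transitivity (2 * (complex.Im (dotp (astar y) (y : H)))%:C * 'i); last by ring.
rewrite -complexiE -im complexiE.
have -> : s * s^* - - kappa%:C * s * (- kappa%:C * s^*)
  = s * s^* * (1 - kappa%:C ^+ 2) by ring.
have -> : 4 * a / (1 + a) ^+ 2 = 1 - kappa ^+ 2.
  by rewrite /kappa; field; rewrite gt_eqF.
by rewrite ss (rmorphB (real_complex R)) (rmorphXn (real_complex R)) rmorph1; ring.
Qed.

End MainOperator.

Section Channel.
Variables (R : realType) (H : hilbertType R) (A : symOp H).
Variable K : {linear R[i]^o -> Hminus A}.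

Lemma channelE c : K c = c *: K 1.
Proof. by rewrite -linearZ /= /GRing.scale /= mulr1. Qed.

Lemma channel_adj_boundary (gp gm f : Hplus A) x y :
  K 1 = x *: riesz_inv gp + y *: riesz_inv gm ->
  channel_adj K f = x^* * dotplus f gp + y^* * dotplus f gm.
Proof.
move=> K1; rewrite /channel_adj /pairing K1 !HminusE !riesz_invE.
by move: (dotplus f gp) (dotplus f gm) => p q; rewrite rmorphD !rmorphM /= !conjCK.
Qed.

End Channel.

(** * Rigidity of the impedance function *)

Section Rigidity.
Variables (R : realType) (H : hilbertType R) (dotA : symOp H).
Variables (gp gm : Hplus dotA) (A : set (H * H)) (g : H) (a : R).
Hypothesis basis : deficiency_basis gp gm.
Hypotheses (dotA_A : dotA `<=` A) (saA : selfadjoint_op A).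
Hypothesis domA : opdom A ((gp : H) - (gm : H)).
Variable Theta : Lsystem dotA.
Hypothesis quasi_kernelA : quasi_kernel (bi_re (state_op Theta)) = A.
Implicit Types (f k : Hplus dotA) (c x y s z : R[i]).

Notation cp f := (dotplus f gp).
Notation cm f := (dotplus f gm).
Notation phi := (riesz_inv gp).
Notation psi := (riesz_inv gm).
Notation K := (channel_op Theta).
Notation B := (state_op Theta).

Lemma boundary_inj x y x' y' : x *: phi + y *: psi = x' *: phi + y' *: psi ->
  x = x' /\ y = y'.
Proof.
move=> e; have [] // := @embed_boundary_inj _ _ _ _ _ basis 0 0 x y x' y'.
by rewrite -!addrA e.
Qed.

(** The imaginary part is the rank-one matrix of the channel vector. The real part annihilates the
    coordinates [(1, -1)] of [gp - gm], so each of its rows is constant, and self-adjointness ties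
    the two rows together. *)
Lemma Lsystem_boundary_matrix : exists s x y,
  [/\ s - s^* = - 'i, K 1 = x *: phi + y *: psi,
      boundary_matrix gp gm (bi_re B) s s s^* s^* &
      boundary_matrix gp gm B (s + 'i * (x^* * x)) (s + 'i * (y^* * x))
                              (s^* + 'i * (x^* * y)) (s^* + 'i * (y^* * y))].
Proof.
have [[TB AT] [TB' AT'] _] := Lsys_state Theta.
have AB : bi_extends dotA B by move=> f h /AT; exact: TB.
have AB' : bi_extends dotA (biadj B) by move=> f h /AT'; exact: TB'.
have [a11 [a12 [a21 [a22 mB]]]] := bi_extension_boundary_matrix basis AB AB'.
(* [Im B] vanishes on such [f]; evaluating [K K^* f] at [f] itself gives [|K 1 f|^2 = 0]. *)
have K1_dom f : graph dotA (f : H, astar f) -> K 1 f = 0.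
  move=> Af; have := Lsys_channel Theta f.
  rewrite /bi_im !biopE (bi_extends_dom AB Af) (bi_extends_dom AB' Af) subrr.
  rewrite scaler0 channelE => /esym/(congr1 (fun u : Hminus dotA => u f)).
  rewrite HminusE /channel_adj /pairing => /eqP.
  by rewrite mulf_eq0 conjC_eq0 orbb => /eqP.
have K1 := Hminus_boundary basis K1_dom.
set x := K 1 gp in K1; set y := K 1 gm in K1.
have im f := etrans (esym (boundary_matrix_im basis f mB)) (Lsys_channel Theta f).
have {}im f :
  (2 * 'i)^-1 * ((a11 - a11^* + 'i) * cp f + (a12 - a21^*) * cm f)
     = (x^* * cp f + y^* * cm f) * x /\
  (2 * 'i)^-1 * ((a21 - a12^*) * cp f + (a22 - a22^* - 'i) * cm f)
     = (x^* * cp f + y^* * cm f) * y.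
  apply: boundary_inj; have := im f.
  by rewrite channelE (channel_adj_boundary _ K1) K1 !scalerDr !scalerA.
(* The basis vectors have coordinates [(1, 0)] and [(0, 1)], which isolates the four entries. *)
have [im11 im21] := im gp; have [im12 im22] := im gm.
move: im11 im21 im12 im22; rewrite (cp_gp basis) (cp_gm basis) (cm_gp basis).
rewrite (cm_gm basis) !mulr1 !mulr0 !addr0 !add0r.
have i0 : 2 * 'i != 0 :> R[i] by rewrite mulf_neq0 ?neq0Ci ?pnatr_eq0.
move=> /(canRL (mulVKf i0)) im11 /(canRL (mulVKf i0)) im21.
move=> /(canRL (mulVKf i0)) im12 /(canRL (mulVKf i0)) im22.
have mR := boundary_matrix_re basis mB.
have /(selfadjoint_extension_dom basis dotA_A saA domA) : cp (gp - gm) + cm (gp - gm) = 0.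
  by rewrite !dotplusE (cp_gp basis) (cp_gm basis) (cm_gp basis) (cm_gm basis); ring.
rewrite -quasi_kernelA => -[F /= Fg]; have {Fg} -> : F = gp - gm by exact: val_inj.
move/(boundary_matrix_embed basis _ _ mR) => [_].
rewrite !dotplusE (cp_gp basis) (cp_gm basis) (cm_gp basis) (cm_gm basis).
rewrite subr0 sub0r !mulr1 !mulrN1 => /eqP; rewrite subr_eq0 => /eqP r12.
move/eqP; rewrite subr_eq0 => /eqP r21.
pose s := (a11 + a11^* - 'i) / 2.
have s12 : s = (a12 + a21^*) / 2 by rewrite /s r12.
have n0 : 2 != 0 :> R[i] by rewrite pnatr_eq0.
have cs : s^* = (a21 + a12^*) / 2.
  rewrite s12 rmorphM fmorphV rmorphD /= conjCK conjC_nat.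
  by congr (_ / _); ring.
have cs' : s^* = (a11^* + a11 + 'i) / 2.
  rewrite /s rmorphM fmorphV rmorphB rmorphD /= conjCK conjC_nat conjCi.
  by congr (_ / _); ring.
exists s, x, y; split=> //.
- by rewrite cs' /s; field.
- by apply: (boundary_matrix_eq mR); rewrite -?s12 -?r21 ?cs.
apply: (boundary_matrix_eq mB).
- transitivity (s + (a11 - a11^* + 'i) / 2); first by rewrite /s; field.
  by rewrite im11; field.
- transitivity (s + (a12 - a21^*) / 2); first by rewrite s12; field.
  by rewrite im12; field.
- transitivity (s^* + (a21 - a12^*) / 2); first by rewrite cs; field.
  by rewrite im21; field.
transitivity (s^* + (a22 - a22^* - 'i) / 2); first by rewrite cs r21; field.
by rewrite im22; field.
Qed.

Hypotheses (a01 : 0 < a < 1) (g1 : `|g| = 1).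
Hypothesis Vi : channel_adj K (bi_resolvent (bi_re B) 'i (K 1))
  = a%:C * weyl_titchmarsh A g 'i.

(** The factor [z^2 + 1] in front of the resolvent term vanishes at [i]. *)
Lemma weyl_titchmarsh_i : weyl_titchmarsh A g 'i = 'i.
Proof.
have linA := selfadjoint_extension_linear dotA_A saA.
rewrite (weyl_titchmarsh_resolvent linA saA g1 (neqCi_conj R)) sqrCi addNr.
by rewrite mul0r addr0.
Qed.

(* Comparing the two functions at the single point ['i] already determines
   the matrix of the state-space operator. *)
Lemma impedance_boundary_matrix : exists m : R[i],
  [/\ m^* * m = 2 * a%:C,
      K 1 = (- ('i / 2 * m)) *: phi + ('i / 2 * m) *: psi &
      boundary_matrix gp gm B
        (- ('i / 2) * (1 - a%:C)) (- ('i / 2) * (1 + a%:C))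
        ('i / 2 * (1 - a%:C)) ('i / 2 * (1 + a%:C))].
Proof.
have [s [x [y [ds K1 mR mB]]]] := Lsystem_boundary_matrix.
have [linT AT TA nsT] := Lsys_main Theta.
have [[TB _] _ _] := Lsys_state Theta.
have i0 : 'i != 0 :> R[i] := neq0Ci _.
have n0 : 2 != 0 :> R[i] by rewrite pnatr_eq0.
have s0 : s != 0.
  apply/eqP => s0; move/eqP: ds; rewrite s0 conjC0 subr0 eq_sym oppr_eq0.
  by apply/negP.
have [f Tf pq0] := nonsymmetric_coef basis TA nsT.
have [F Ff] := TB _ _ Tf; have {Ff F} -> : F = f by exact: val_inj.
move/(boundary_matrix_embed basis _ _ mB) => [_].
set p := cp f in pq0 *; set q := cm f in pq0 *; set w := x^* * p + y^* * q.
move=> e1 e2.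
have {}e1 : s * (p + q) + 'i * w * x = 0 by rewrite -[RHS]e1 /w; ring.
have {}e2 : s^* * (p + q) + 'i * w * y = 0 by rewrite -[RHS]e2 /w; ring.
(* [w] is [K^* f]. Since it is nonzero, the two row equations make [(x, y)] proportional to [s] and
   its conjugate. *)
have w0 : w != 0.
  apply: contra_neq pq0 => w0; move: e1; rewrite w0 mulr0 mul0r addr0 => /eqP.
  by rewrite mulf_eq0 (negPf s0) => /eqP.
have [m [xE yE]] : exists m, x = m * s /\ y = m * s^*.
  exists ('i * (p + q) / w); split; apply: (mulfI (mulf_neq0 i0 w0)).
    by move/eqP: e1; rewrite addrC addr_eq0 => /eqP ->; field: (mulCii R[i]).
  by move/eqP: e2; rewrite addrC addr_eq0 => /eqP ->; field: (mulCii R[i]).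
(* At [i] every solution is a multiple of [gp], and the first row fixes the factor. *)
have res : bi_resolvent (bi_re B) 'i (K 1) = m *: gp.
  rewrite K1; apply: (bi_resolvent_eq basis mR) => k; split=> [[kz kx ky]|->].
    have [c kc] := defect_gp basis kz; rewrite kc; congr (_ *: _).
    apply: (mulfI s0); rewrite -[RHS]mulrC -xE -kx kc !dotplusE.
    by rewrite (cp_gp basis) (cm_gp basis) !mulr0 addr0 mulr1.
  rewrite !dotplusE (cp_gp basis) (cm_gp basis) !mulr0 !addr0 mulr1.
  rewrite astarZ (astar_gp basis) Hplus_valZ !scalerA mulrC.
  by split; rewrite // ?xE ?yE mulrC.
move: Vi; rewrite res weyl_titchmarsh_i (channel_adj_boundary _ K1).
rewrite !dotplusE (cp_gp basis) (cm_gp basis) !mulr0 addr0 mulr1 xE rmorphM.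
move=> /= e.
have ac : (a%:C)^* = a%:C :> R[i] by exact: conjc_real.
(* The conjugate of [e]. Subtracting the two and using [s - s^* = -i] gives [|m|^2 = 2a], and then
   [s = -i/2]. *)
have e' : m^* * m * s = - 'i * a%:C.
  have /= := congr1 Num.conj e; rewrite !rmorphM /= !conjCK ac conjCi => e'.
  by transitivity (a%:C * - 'i); [rewrite -e'; ring | ring].
have mm : m^* * m = 2 * a%:C.
  apply: (mulIf i0); transitivity (- (m^* * m * (s - s^*))); first by rewrite ds; ring.
  by rewrite mulrBr e' [_ * s^*]mulrAC e; ring.
have a0 : a%:C != 0 :> R[i].
  by case/andP: a01 => a0 _; exact: complex_neq0.
have sE : s = - ('i / 2).
  by apply: (mulfI (mulf_neq0 n0 a0)); rewrite -mm e' mm; field.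
have sE' : s^* = 'i / 2.
  by rewrite sE rmorphN rmorphM fmorphV /= conjCi conjC_nat; field.
exists m; split=> //; first by rewrite K1 xE yE sE' sE mulrN ![m * _]mulrC.
have xc : x^* = 'i / 2 * m^* by rewrite xE rmorphM /= sE' mulrC.
have yc : y^* = - ('i / 2) * m^* by rewrite yE rmorphM /= conjCK sE mulrC.
have i2 := mulCii R[i].
apply: (boundary_matrix_eq mB).
- by rewrite sE xc xE sE; field: i2 mm.
- by rewrite sE yc xE sE; field: i2 mm.
- by rewrite sE' xc yE sE'; field: i2 mm.
- by rewrite sE' yc yE sE'; field: i2 mm.
Qed.

Theorem impedance_c_entropy : c_entropy Theta = (ln (1 + a) - ln (1 - a))%:E.
Proof.
have [m [mm K1 mB]] := impedance_boundary_matrix.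
apply: transfer_c_entropy => //.
have i0 : 'i != 0 :> R[i] := neq0Ci _.
have c0 : 1 + a%:C != 0 :> R[i].
  by case/andP: a01 => a0 _; exact: complex1D_neq0.
have h0 : 'i / 2 * (1 + a%:C) != 0 by rewrite !mulf_neq0 // invr_neq0 ?pnatr_eq0.
(* At [-i] the solution is a multiple of [gm], fixed by the second row. The transfer function is
   then [1 - |m|^2 / (1 + a)] with [|m|^2 = 2a]. *)
have res : bi_resolvent B (- 'i) (K 1) = (m / (1 + a%:C)) *: gm.
  rewrite K1; apply: (bi_resolvent_eq basis mB) => k; split=> [[kz _ ky]|->].
    have [c kc] := defect_gm basis kz; rewrite kc; congr (_ *: _).
    apply: (mulfI h0); move: ky; rewrite kc !dotplusE (cp_gm basis) (cm_gm basis).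
    by rewrite !mulr0 add0r mulr1 => ->; field.
  rewrite !dotplusE (cp_gm basis) (cm_gm basis) !mulr0 !add0r mulr1.
  rewrite astarZ (astar_gm basis) Hplus_valZ !scalerA mulrC.
  by split=> //; field.
rewrite /transfer res (channel_adj_boundary _ K1) !dotplusE (cp_gm basis) (cm_gm basis).
have -> : ('i / 2 * m)^* = - ('i / 2) * m^*.
  by rewrite !rmorphM fmorphV /= conjCi conjC_nat; ring.
rewrite rmorphM fmorphV rmorphB rmorphD rmorph1 /=.
by field: (mulCii R[i]) mm.
Qed.

Theorem impedance_dissipation :
  dissipation_coefficient (main_op Theta) gp gm (4 * a / (1 + a) ^+ 2).
Proof.
have [m [mm K1 mB]] := impedance_boundary_matrix.
have [linT AT TA nsT] := Lsys_main Theta.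
have [[TB _] _ _] := Lsys_state Theta.
apply: (main_operator_dissipation basis) => //.
have [f Tf pq0] := nonsymmetric_coef basis TA nsT.
have [F Ff] := TB _ _ Tf; have {Ff F} -> : F = f by exact: val_inj.
move/(boundary_matrix_embed basis _ _ mB) => [_ _ e].
exists f; split=> //; have i0 : 'i != 0 :> R[i] := neq0Ci _.
have h0 : 'i / 2 != 0 :> R[i] by rewrite mulf_neq0 // invr_neq0 ?pnatr_eq0.
apply: (mulfI h0); rewrite mulr0 -[RHS]e rmorphB rmorphD rmorph1 /=; ring.
Qed.

End Rigidity.

(** * The L-system realizing [aM] *)

Section LineChannel.
Variables (R : realType) (H : hilbertType R) (A : symOp H) (u : Hminus A).

Definition line_channel (c : R[i]^o) : Hminus A := c *: u.

Lemma line_channel_linear : linear line_channel.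
Proof. by move=> c x y; rewrite /line_channel scalerDl scalerA. Qed.

HB.instance Definition _ :=
  GRing.isLinear.Build R[i] R[i]^o (Hminus A) *:%R line_channel line_channel_linear.

End LineChannel.

Section Realization.
Variables (R : realType) (H : hilbertType R) (dotA : symOp H).
Variables (gp gm : Hplus dotA) (A : set (H * H)) (g : H) (a : R).
Hypothesis basis : deficiency_basis gp gm.
Hypotheses (dotA_A : dotA `<=` A) (saA : selfadjoint_op A).
Hypothesis domA : opdom A ((gp : H) - (gm : H)).
Hypotheses (a01 : 0 < a < 1).
Hypotheses (g1 : `|g| = 1) (Ng : defect_space dotA 'i g).
Implicit Types (f k : Hplus dotA) (c x y s z : R[i]).

Notation cp f := (dotplus f gp).
Notation cm f := (dotplus f gm).
Notation phi := (riesz_inv gp).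
Notation psi := (riesz_inv gm).

Let conjC_real (r : R) : (r%:C)^* = r%:C :> R[i]. Proof. exact: conjc_real. Qed.

Let conjC1B : (1 - a%:C)^* = 1 - a%:C.
Proof. by rewrite (rmorphB Num.conj) rmorph1 /= conjC_real. Qed.

Let conjC1D : (1 + a%:C)^* = 1 + a%:C.
Proof. by rewrite (rmorphD Num.conj) rmorph1 /= conjC_real. Qed.

Let conjC_i2 x : ('i / 2 * x)^* = - ('i / 2) * x^*.
Proof. by rewrite !(rmorphM Num.conj) fmorphV /= conjCi conjC_nat; ring. Qed.

Let conjC_Ni2 x : (- ('i / 2) * x)^* = 'i / 2 * x^*.
Proof. by rewrite mulNr (rmorphN Num.conj) /= conjC_i2; ring. Qed.

Let ac : (a%:C)^* = a%:C :> R[i]. Proof. exact: conjc_real. Qed.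

Let a0C : a%:C != 0 :> R[i].
Proof. by case/andP: a01 => a0 _; exact: complex_neq0. Qed.

Let a1C : 1 + a%:C != 0 :> R[i].
Proof. by case/andP: a01 => a0 _; exact: complex1D_neq0. Qed.

Definition realization_op : biop dotA := bi_astar dotA
  - ('i / 2) *: rank_one ((1 - a)%:C *: phi + (1 + a)%:C *: psi) (phi - psi).

Definition realization_channel : {linear R[i]^o -> Hminus dotA} :=
  line_channel ((Num.sqrt (a / 2))%:C *: (phi - psi)).

(** The quasi-kernel of [realization_op]: both rows of its boundary matrix are multiples of this
    equation. *)
Definition realization_main : set (H * H) := [set p | exists f,
  [/\ (f : H) = p.1, astar f = p.2 & (1 - a%:C) * cp f + (1 + a%:C) * cm f = 0]].

Lemma realization_op_matrix : boundary_matrix gp gm realization_op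
  (- ('i / 2) * (1 - a%:C)) (- ('i / 2) * (1 + a%:C))
  ('i / 2 * (1 - a%:C)) ('i / 2 * (1 + a%:C)).
Proof.
apply: boundary_matrixP => f k; rewrite /realization_op !biopE !HminusE.
rewrite /pairing !HminusE !riesz_invE.
rewrite -[bi_astar dotA f k]/(dotp (astar f) (k : H)).
move: (cp f) (cm f) (cp k) (cm k) => p q p' q'.
rewrite (rmorphD Num.conj) !(rmorphM Num.conj) /= !conjCK !conjC_real.
by rewrite !(rmorphD, rmorphB) rmorph1 /=; ring.
Qed.

(** Adjunction amounts to replacing [a] by [-a]; in the real part [a] therefore drops out. *)
Lemma realization_adj_matrix : boundary_matrix gp gm (biadj realization_op)
  (- ('i / 2) * (1 + a%:C)) (- ('i / 2) * (1 - a%:C))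
  ('i / 2 * (1 + a%:C)) ('i / 2 * (1 - a%:C)).
Proof.
apply: (boundary_matrix_eq (boundary_matrix_biadj basis realization_op_matrix));
  by rewrite ?conjC_i2 ?conjC_Ni2 ?conjC1B ?conjC1D; field.
Qed.

Lemma realization_re_matrix : boundary_matrix gp gm (bi_re realization_op)
  (- ('i / 2)) (- ('i / 2)) ('i / 2) ('i / 2).
Proof.
apply: (boundary_matrix_eq (boundary_matrix_re basis realization_op_matrix));
  by rewrite ?conjC_i2 ?conjC_Ni2 ?conjC1B ?conjC1D; field.
Qed.

Lemma realization_mainP f : realization_main (f : H, astar f) <->
  (1 - a%:C) * cp f + (1 + a%:C) * cm f = 0.
Proof.
split=> [[k /= [kf _]]|e]; last by exists f.
by have -> : k = f by exact: val_inj.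
Qed.

Lemma realization_main_linear : linear_operator realization_main.
Proof.
split=> [|c p q [f [f1 f2 e]] [k [k1 k2 e']]|h [f /= [f0 <- e]]].
- exists 0; rewrite astar0; split=> //.
  by rewrite -(scale0r (0 : Hplus dotA)) !dotplusZ !mul0r !mulr0 addr0.
- exists (c *: f + k); split.
  + by rewrite Hplus_valD Hplus_valZ f1 k1.
  + by rewrite astar_linear f2 k2.
  transitivity (c * ((1 - a%:C) * cp f + (1 + a%:C) * cm f)
                + ((1 - a%:C) * cp k + (1 + a%:C) * cm k)).
    by rewrite !dotplusP; ring.
  by rewrite e e' mulr0 addr0.
have -> : f = 0 by exact: val_inj.
exact: astar0.
Qed.

Lemma realization_main_ext : dotA `<=` realization_main.
Proof.
move=> -[f h] Af; have [F Ff Fh] := adjoint_Hplus (symOp_symmetric Af).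
have AF : graph dotA (F : H, astar F) by rewrite Ff Fh.
by exists F; rewrite (cp_dom basis AF) (cm_dom basis AF) !mulr0 addr0.
Qed.

Lemma realization_main_adjoint : realization_main `<=` adjoint dotA.
Proof. by move=> -[f h] [F /= [<- <- _]]; exact: astarP. Qed.

Lemma realization_adjoint_ext : dotA `<=` adjoint realization_main.
Proof.
move=> [f h] Af k l [F /= [<- <- _]].
by have := astarP F Af => /= /(congr1 Num.conj); rewrite -!dotpC => ->.
Qed.

Lemma realization_bi_extends : bi_extends realization_main realization_op.
Proof.
move=> f h [F /= [Ff Fh e]]; exists F => //; rewrite -Fh.
apply/(boundary_matrix_embed basis _ _ realization_op_matrix); split=> //.
  by rewrite -[RHS](mulr0 (- ('i / 2))) -e; ring.
by rewrite -[RHS](mulr0 ('i / 2)) -e; ring.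
Qed.

(* Spans the domain of the main operator modulo that of [dotA]. *)
Let y : Hplus dotA := (1 + a%:C) *: gp - (1 - a%:C) *: gm.

Let cpy : cp y = 1 + a%:C.
Proof. by rewrite !dotplusE (cp_gp basis) (cp_gm basis); ring. Qed.

Let cmy : cm y = - (1 - a%:C).
Proof. by rewrite !dotplusE (cm_gp basis) (cm_gm basis); ring. Qed.

Let Ty : realization_main (y : H, astar y).
Proof. by apply/realization_mainP; rewrite cpy cmy; ring. Qed.

Lemma realization_bi_extends_adjoint :
  bi_extends (adjoint realization_main) (biadj realization_op).
Proof.
move=> f h Tf.
have Af : adjoint dotA (f, h) by move=> k l /realization_main_ext; exact: Tf.
have [F Ff Fh] := adjoint_Hplus Af; exists F => //.
(* Testing against the single vector [y] in Green's formula yields the row equation of the adjoint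
   matrix. *)
have e : (1 + a%:C) * cp F + (1 - a%:C) * cm F = 0.
  have := green basis y F; rewrite Ff Fh (Tf _ _ Ty) subrr cpy cmy.
  move=> /esym/eqP; rewrite mulf_eq0 (negPf (neq0Ci _)) /= => /eqP/(congr1 Num.conj).
  move: (cp F) (cm F) => p q.
  rewrite !(rmorphM, rmorphN, rmorphD, rmorphB, rmorph1, rmorph0) /= !conjCK ac.
  by move=> <-; ring.
rewrite -Fh; apply/(boundary_matrix_embed basis _ _ realization_adj_matrix); split=> //.
  by rewrite -[RHS](mulr0 (- ('i / 2))) -e; ring.
by rewrite -[RHS](mulr0 ('i / 2)) -e; ring.
Qed.

(** On [(y, y)] the boundary form equals [(1 + a)^2 - (1 - a)^2 = 4a], up to the factor [i]. *)
Lemma realization_nonsymmetric : ~ symmetric_op realization_main.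
Proof.
move=> sym; have := green basis y y; rewrite (sym _ Ty _ _ Ty) subrr cpy cmy.
rewrite !(rmorphN, rmorphD, rmorphB, rmorph1) /= ac => /esym/eqP.
rewrite mulf_eq0 (negPf (neq0Ci _)) /=.
have -> : (1 + a%:C) * (1 + a%:C) - - (1 - a%:C) * - (1 - a%:C) = 4 * a%:C by ring.
by rewrite mulf_eq0 (negPf a0C) pnatr_eq0.
Qed.

Lemma realization_quasi_kernel : quasi_kernel (bi_re realization_op) = A.
Proof.
rewrite seteqP; split=> -[f h].
  move=> [F /= Ff /(boundary_matrix_embed basis _ _ realization_re_matrix)].
  move=> [-> _ e]; rewrite -Ff.
  apply/(selfadjoint_extension_dom basis dotA_A saA domA).
  have h0 : 'i / 2 != 0 :> R[i] by rewrite mulf_neq0 ?neq0Ci // invr_neq0 ?pnatr_eq0.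
  by apply: (mulfI h0); rewrite mulr0 mulrDr.
move=> Af; have [F Ff Fh] := adjoint_Hplus (selfadjoint_extension_adjoint dotA_A saA Af).
have /(selfadjoint_extension_dom basis dotA_A saA domA) e : A (F : H, astar F).
  by rewrite Ff Fh.
exists F => //; apply/(boundary_matrix_embed basis _ _ realization_re_matrix).
by rewrite !mulNr -opprD -!mulrDr e mulr0 oppr0.
Qed.

Lemma realization_star_extension : star_extension realization_main realization_op.
Proof.
split.
- split; [exact: realization_bi_extends | exact: realization_main_ext].
- split; [exact: realization_bi_extends_adjoint | exact: realization_adjoint_ext].
split; last by rewrite realization_quasi_kernel.
split; last by rewrite bi_re_adj.
move=> f h Af; have [F Ff Fh] := adjoint_Hplus (symOp_symmetric Af).
have AF : graph dotA (F : H, astar F) by rewrite Ff Fh.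
exists F => //; apply/(boundary_matrix_embed basis _ _ realization_re_matrix).
by rewrite (cp_dom basis AF) (cm_dom basis AF) !mulr0 !addr0.
Qed.

(** The domain equation gives [(1 + a) |q| = (1 - a) |p|], so [|q| <= |p|] and the boundary form is
    nonnegative. *)
Let dissipationE f : realization_main (f : H, astar f) ->
  exists2 r : R[i], 0 <= r &
  dotp (astar f) (f : H) - (dotp (astar f) (f : H))^* = 'i * r.
Proof.
move=> /realization_mainP; set p := cp f; set q := cm f => e.
have {}e : (1 + a%:C) * q = - ((1 - a%:C) * p).
  by move/eqP: e; rewrite addrC addr_eq0 => /eqP.
exists (p * p^* - q * q^*); last by rewrite -dotpC (green basis).
have /andP[/ltW a0 /ltW a1] := a01.
have b0 : 0 < 1 + a%:C :> R[i].
  by rewrite lt_def a1C addr_ge0 // -[0]/(0%:C) lecR.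
have c0 : 0 <= 1 - a%:C :> R[i] by rewrite subr_ge0 -[1]/(1%:C) lecR.
rewrite -!normCK subr_ge0 lerXn2r ?nnegrE // -(ler_pM2l b0).
have := congr1 Num.norm e; rewrite normrN !normrM (gtr0_norm b0) (ger0_norm c0) => ->.
rewrite ler_wpM2r // lerD2l; apply: (@le_trans _ _ 0).
  by rewrite oppr_le0 -[0]/(0%:C) lecR.
by rewrite -[0]/(0%:C) lecR.
Qed.

Lemma realization_dissipative : dissipative realization_main.
Proof.
move=> f h [F /= [Ff Fh e]].
have /dissipationE [r r0] : realization_main (F : H, astar F) by apply/realization_mainP.
rewrite Ff Fh => im; have := subcJ (dotp h f); rewrite [LHS]im -complexiE.
rewrite mulrC => /mulIf rE; move: r0; rewrite rE; last by rewrite complexiE neq0Ci.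
by rewrite pmulr_rge0 // -[0]/(0%:C) lecR.
Qed.

(** Dissipativity makes the imaginary part of [((T + i) f, f)] at least [|f|^2]. This yields both
    injectivity and the resolvent bound at [-i]. *)
Lemma realization_lower_bound f (h : H) : realization_main (f : H, h) ->
  `|f : H| <= `|h + 'i *: (f : H)|.
Proof.
move=> Tf; have fh := astar_eq (realization_main_adjoint Tf); rewrite -fh in Tf *.
have [r r0 im] := dissipationE Tf.
have [->|f0] := eqVneq (f : H) 0; first by rewrite normr0.
have nf : 0 < `|f : H| by rewrite normr_gt0.
rewrite -(ler_pM2r nf) -expr2; apply: (le_trans _ (cauchy_schwarz _ _)).
set u := dotp _ _.
have uE : u - u^* = 'i * (r + 2 * `|f : H| ^+ 2).
  rewrite /u !dotpl (rmorphD Num.conj) (rmorphM Num.conj) /= conjCi.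
  rewrite -[X in _ = X]addr0 mulrDr -im -dotp_norm -(dotpC (f : H) (f : H)); ring.
rewrite -(ler_pM2l (ltr0Sn _ 1)).
have -> : 2 * `|u| = `|u| + `|u^*| by rewrite norm_conjC; ring.
apply: le_trans (ler_normB _ _); rewrite uE normrM normCi mul1r ger0_norm.
  by rewrite lerDr.
by rewrite addr_ge0 // mulr_ge0 // exprn_ge0.
Qed.

Lemma realization_resolvent : resolvent_set realization_main (- 'i).
Proof.
have i0 : 'i != 0 :> R[i] := neq0Ci _.
have [T0 linT _] := realization_main_linear.
split; last first.
  exists 1 => f h Tf; rewrite mul1r scaleNr opprK.
  have [F [/= Ff _ _]] := Tf; rewrite -Ff in Tf *; exact: realization_lower_bound.
move=> h.
have [f' [k [n [Af' Nn hE]]]] := range_decomposition (symOp_linear dotA)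
  (@symOp_symmetric _ _ dotA) (@symOp_closed _ _ dotA) (neqNCi_conj R) h.
have [f0 f0E f0k] := adjoint_Hplus (symOp_symmetric Af').
have [n' n'E n'k] := adjoint_Hplus Nn.
move: n'k; rewrite -n'E (rmorphN Num.conj) /= conjCi opprK => /(defect_gp basis) [c nc].
have A0 : graph dotA (f0 : H, astar f0) by rewrite f0E f0k.
(* [A^* + i] kills [gm] and sends [y] to [2i (1 + a) gp], so this multiple of [y] accounts for the
   component [c *: gp]. *)
pose F := (c / (2 * 'i * (1 + a%:C))) *: y + f0.
have TF : realization_main (F : H, h + - 'i *: (F : H)).
  have -> : h + - 'i *: (F : H) = astar F.
    rewrite hE -n'E nc /F /y !HplusE f0k f0E (astar_gp basis) (astar_gm basis).
    by apply: dotp_ext => x; rewrite !dotpl; field; rewrite ?i0 ?a1C.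
  apply/realization_mainP; rewrite /F (dotplusP _ y f0 gp) (dotplusP _ y f0 gm) cpy cmy.
  by rewrite (cp_dom basis A0) (cm_dom basis A0); ring.
exists (F : H); split=> // f Tf.
have [G [/= Gf _ _]] := Tf; rewrite -Gf in Tf *.
have Td := linT (-1) _ _ TF Tf.
have := @realization_lower_bound ((-1) *: F + G) _ Td.
have -> : (-1) *: (h + - 'i *: (F : H)) + (h + - 'i *: (G : H))
    + 'i *: (((-1) *: F + G : Hplus dotA) : H) = 0.
  by rewrite Hplus_valD Hplus_valZ; apply: dotp_ext => x; rewrite !dotpl; ring.
rewrite normr0 normr_le0 Hplus_valD Hplus_valZ scaleN1r addrC subr_eq0.
by move=> /eqP.
Qed.

Let sg : R[i] := (Num.sqrt (a / 2))%:C.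

Let sg2 : sg * sg = a%:C / 2.
Proof.
case/andP: a01 => a0 _; rewrite /sg -rmorphM /= -expr2 sqr_sqrtr ?divr_ge0 ?ltW //.
by rewrite rmorphM fmorphV rmorph_nat.
Qed.

Let sg_conj : sg^* = sg. Proof. exact: conjC_real. Qed.

Let channel1 : realization_channel 1 = sg *: phi + (- sg) *: psi.
Proof. by rewrite /realization_channel /= /line_channel scale1r scalerBr scaleNr. Qed.

Let channel_adjE f : channel_adj realization_channel f = sg * (cp f - cm f).
Proof.
by rewrite (channel_adj_boundary _ channel1) (rmorphN Num.conj) /= sg_conj; ring.
Qed.

Lemma realization_channelP f :
  bi_im realization_op f = realization_channel (channel_adj realization_channel f).
Proof.
rewrite (boundary_matrix_im basis f realization_op_matrix).
rewrite channelE channel1 channel_adjE !conjC_i2 !conjC_Ni2 conjC1B conjC1D.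
apply: HminusP => k; rewrite !HminusE !riesz_invE.
move: (cp f) (cm f) (cp k) (cm k) => p q p' q'.
transitivity ('i / (2 * 'i) * (a%:C * (p - q) * (p'^* - q'^*))).
  by field; rewrite neq0Ci.
transitivity (sg * sg * (p - q) * (p'^* - q'^*)); last by ring.
by rewrite sg2; field; rewrite neq0Ci.
Qed.

Definition realization : Lsystem dotA :=
  @LSystem _ _ _ realization_main realization_op realization_channel
    (let: And5 defA _ _ _ _ := basis in defA)
    (And4 realization_main_linear realization_main_ext
          realization_main_adjoint realization_nonsymmetric)
    realization_dissipative
    (ex_intro _ (- 'i) realization_resolvent)
    realization_star_extension
    realization_channelP.

Let linA : linear_operator A := selfadjoint_extension_linear dotA_A saA.

Lemma realization_impedance_value z : z != z^* ->
  channel_adj realization_channel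
    (bi_resolvent (bi_re realization_op) z (realization_channel 1))
  = a%:C * (z + (z ^+ 2 + 1) * dotp (resolvent A z g) g).
Proof.
move=> znr; have i0 : 'i != 0 :> R[i] := neq0Ci _.
have ARz := resolventP linA saA g znr.
have [r rE rs] := adjoint_Hplus (selfadjoint_extension_adjoint dotA_A saA ARz).
have pqr : cp r + cm r = 0.
  by apply/(selfadjoint_extension_dom basis dotA_A saA domA); rewrite rE rs.
have [G GE Gs] := adjoint_Hplus Ng.
have Gi : astar G = 'i *: (G : H) by rewrite Gs GE.
have [c Gc] := defect_gp basis Gi.
have gc : g = c *: (gp : H) by rewrite -GE Gc.
(* [g] has norm 1 in H while the square of that of [gp] is [1/2]. *)
have cc : c * c^* = 2.
  have := dotp_norm g; rewrite g1 expr1n gc dotpZl dotpZr (dotp_gp basis) => e.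
  have n0 : 2 != 0 :> R[i] by rewrite pnatr_eq0.
  by apply: (mulIf (invr_neq0 n0)); rewrite mulfV // -[RHS]e; ring.
have c0 : c != 0.
  by apply/eqP => c0; move/eqP: cc; rewrite c0 mul0r eq_sym pnatr_eq0.
have dgp (x : H) : dotp x (gp : H) = c / 2 * dotp x g.
  by rewrite gc dotpZr mulrA [c / 2 * _]mulrAC cc mulfV ?pnatr_eq0 // mul1r.
have cpr : cp r = c / 2 * (dotp (r : H) g - 'i * (1 + z * dotp (r : H) g)).
  by rewrite (cpE basis) rs -rE !dotpl !dgp dotp_norm g1; ring.
(* With [r = (A - z I)^-1 g] this is a defect vector at [z], and [p(u) + q(u) = c] because [r] lies
   in the domain of [A]. *)
pose u := G + (z - 'i) *: r.
have us : astar u = z *: (u : H).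
  rewrite /u !HplusE Gi rs -rE GE; apply: dotp_ext => x; rewrite !dotpl; ring.
have pu : cp u = c + (z - 'i) * cp r.
  by rewrite /u !dotplusE Gc dotplusZ (cp_gp basis) mulr1.
have qu : cm u = - (z - 'i) * cp r.
  rewrite /u !dotplusE Gc dotplusZ (cm_gp basis) mulr0 add0r.
  by rewrite -[cm r](addKr (cp r)) pqr; ring.
have ifn : - ('i / 2) != 0 :> R[i].
  by rewrite oppr_eq0 mulf_neq0 // invr_neq0 // pnatr_eq0.
(* Scaled so that [-i/2 * (p + q)] equals the first channel coefficient [sg]. *)
pose f := (2 * 'i * sg / c) *: u.
rewrite channel1 (bi_resolvent_eq (f := f) basis realization_re_matrix).
  rewrite channel_adjE /f !dotplusZ pu qu cpr rE.
  set m := dotp _ _.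
  transitivity (sg * sg * 2 * 'i * (1 + (z - 'i) * (m - 'i * (1 + z * m)))).
    by field.
  by rewrite sg2; field: (mulCii R[i]).
move=> k; split=> [[ks e _]|->]; last first.
  rewrite /f !dotplusZ pu qu astarZ us Hplus_valZ !scalerA [z * _]mulrC.
  by split=> //; field: (mulCii R[i]).
suff kf : (k : H) = f by exact: val_inj.
have fs : astar f = z *: (f : H) by rewrite /f astarZ us Hplus_valZ !scalerA mulrC.
(* Two solutions have the same [p + q], so their difference lies in the domain of [A] as an
   eigenvector for the nonreal [z], hence is zero. *)
have Af : A ((k - f : Hplus dotA) : H, astar (k - f)).
  apply/(selfadjoint_extension_dom basis dotA_A saA domA); apply: (mulfI ifn).
  rewrite mulr0 !dotplusB.
  transitivity (- ('i / 2) * cp k + - ('i / 2) * cm k + 'i / 2 * (cp f + cm f)).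
    by ring.
  by rewrite e /f !dotplusZ pu qu; field: (mulCii R[i]).
have A0 : A (0, 0 + z *: 0) by rewrite scaler0 addr0; case: linA.
apply/eqP; rewrite -subr_eq0; apply/eqP.
apply: (resolvent_uniq linA saA (h := 0) znr _ A0).
by move: Af; rewrite astarB ks fs Hplus_valB scalerBr add0r.
Qed.

Lemma realization_impedance :
  exists2 V : R[i] -> R[i], is_impedance realization V &
    forall z, 0 < complex.Im z -> V z = a%:C * weyl_titchmarsh A g z.
Proof.
(* The resolvent form of [a M] covers both half-planes and displays analyticity through
   [derivable_resolvent]. *)
exists (fun z => a%:C * (z + (z ^+ 2 + 1) * dotp (resolvent A z g) g)).
  move=> z; rewrite Im_neq0 => znr; split.
    by rewrite /= (realization_impedance_value znr).
  apply: derivableM; first exact: derivable_cst.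
  apply: derivableD; first exact: derivable_id.
  apply: derivableM; last exact: derivable_resolvent.
  apply: (@derivable_quadratic _ (fun w => w ^+ 2 + 1) z (2 * z) 1 1) => // t _.
  by rewrite mul1r -normrX le_eqVlt; apply/orP; left; apply/eqP; congr `| _ |; ring.
move=> z z0; rewrite (weyl_titchmarsh_resolvent linA saA g1) //.
by rewrite -Im_neq0 gt_eqF.
Qed.

End Realization.

Theorem theorem14 (R : realType) (H : hilbertType R) (dotA : symOp H)
    (gp gm : Hplus dotA) (A : set (H * H)) (g : H) (a : R) :
  deficiency_indices_11 dotA ->
  defect_space dotA 'i gp -> defect_space dotA (- 'i) gm ->
  normplus gp = 1 -> normplus gm = 1 ->
  dotA `<=` A -> selfadjoint_op A -> opdom A (gp - gm) ->
  defect_space dotA 'i g -> `|g| = 1 ->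
  0 < a < 1 ->
  let phi := riesz_inv gp in
  let psi := riesz_inv gm in
  (exists Theta : Lsystem dotA,
    [/\ state_op Theta = bi_astar dotA
          - ('i / 2) *: rank_one ((1 - a)%:C *: phi + (1 + a)%:C *: psi)
                                 (phi - psi),
        forall c : R[i],
          channel_op Theta c = (c * (Num.sqrt (a / 2))%:C) *: (phi - psi),
        exists2 V : R[i] -> R[i], is_impedance Theta V &
          forall z, 0 < complex.Im z -> V z = a%:C * weyl_titchmarsh A g z,
        c_entropy Theta = (ln (1 + a) - ln (1 - a))%:E
      & dissipation_coefficient (main_op Theta) gp gm
          (4 * a / (1 + a) ^+ 2)])
  /\
  (forall (Theta : Lsystem dotA) (V : R[i] -> R[i]),
    is_impedance Theta V ->
    quasi_kernel (bi_re (state_op Theta)) = A ->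
    (forall z, 0 < complex.Im z -> V z = a%:C * weyl_titchmarsh A g z) ->
    c_entropy Theta = (ln (1 + a) - ln (1 - a))%:E /\
    dissipation_coefficient (main_op Theta) gp gm (4 * a / (1 + a) ^+ 2)).
Proof.
move=> defA Ngp Ngm gp1 gm1 dotA_A saA domA Ng g1 a01 phi psi.
have basis : deficiency_basis gp gm by split.
have im_i : complex.Im ('i : R[i]) = 1 by rewrite -complexiE.
have rigid (Theta : Lsystem dotA) (V : R[i] -> R[i]) : is_impedance Theta V ->
    quasi_kernel (bi_re (state_op Theta)) = A ->
    (forall z, 0 < complex.Im z -> V z = a%:C * weyl_titchmarsh A g z) ->
    c_entropy Theta = (ln (1 + a) - ln (1 - a))%:E /\
    dissipation_coefficient (main_op Theta) gp gm (4 * a / (1 + a) ^+ 2).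
  move=> impV qkA VM.
  have Vi : channel_adj (channel_op Theta)
      (bi_resolvent (bi_re (state_op Theta)) 'i (channel_op Theta 1))
    = a%:C * weyl_titchmarsh A g 'i.
    rewrite -VM ?im_i ?ltr01 //; have [|<-] // := impV 'i.
    by rewrite im_i oner_neq0.
  split.
    exact: (impedance_c_entropy basis dotA_A saA domA qkA a01 g1 Vi).
  exact: (impedance_dissipation basis dotA_A saA domA qkA a01 g1 Vi).
split; last exact: rigid.
pose Theta := realization basis dotA_A saA domA a01.
have [V impV VM] := realization_impedance basis dotA_A saA domA a01 g1 Ng.
have qkA : quasi_kernel (bi_re (state_op Theta)) = A.
  exact: (realization_quasi_kernel a basis dotA_A saA domA).
(* The constructed system satisfies the hypotheses of the converse, which supplies its entropy and
   dissipation coefficient. *)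
have [S D] := rigid Theta V impV qkA VM.
exists Theta; split=> //; last by exists V.
by move=> c; rewrite /= /line_channel scalerA.
Qed.
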